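(* Let $A$ be a compact topological space and $M$ a $C^\infty$ manifold. Then the mapping space $C(A,M)$ of continuous maps, with its compact-open topology, has a ($C^\infty$) Banach manifold structure.
   Context: $M$ is finite-dimensional and without boundary. The underlying topology of the Banach manifold structure is the compact-open topology. *)

(* Defs.v *)
From HB Require Import structures.
From mathcomp Require Import all_boot all_order all_algebra.
From mathcomp Require Import all_classical all_reals all_analysis.
Set Implicit Arguments.
Unset Strict Implicit.
Unset Printing Implicit Defensive.
Import Order.TTheory GRing.Theory Num.Theory.
Import numFieldNormedType.Exports.
Local Open Scope classical_set_scope.
Local Open Scope ring_scope.

Section clinear_def.
Context {R : realType} {E F : normedModType R}.

Definition clinear_pred : {pred E -> F} :=
  [pred f : E -> F | `[< linear f /\ continuous f >]].

Record clinear := Clinear {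
  clinear_fun :> E -> F;
  clinear_funP : clinear_fun \in clinear_pred }.

HB.instance Definition _ := [isSub for clinear_fun].
HB.instance Definition _ := [Choice of clinear by <:].

Lemma clinear_submod_closed : submod_closed clinear_pred.
Proof.
split.
- apply/asboolP; split; last by move=> x; exact: cvg_cst.
  by move=> a u v; rewrite scaler0 addr0.
- move=> a f g /asboolP[lf cf] /asboolP[lg cg]; apply/asboolP; split.
  + move=> b u v; rewrite !fctE lf lg !scalerDr !scalerA (mulrC a b).
    by rewrite addrACA.
  + move=> x; apply: cvgD; last exact: cg.
    by apply: cvgZr; exact: cf.
Qed.

HB.instance Definition _ :=
  GRing.isSubmodClosed.Build R (E -> F) clinear_pred clinear_submod_closed.
HB.instance Definition _ := [SubChoice_isSubLmodule of clinear by <:].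

Lemma clinear_linear (f : clinear) : linear f.
Proof. by have /asboolP[] := clinear_funP f. Qed.

Lemma clinear_continuous (f : clinear) : continuous f.
Proof. by have /asboolP[] := clinear_funP f. Qed.

HB.instance Definition _ (f : clinear) :=
  GRing.isLinear.Build R E F *:%R f (@clinear_linear f).

Lemma clinearP (f g : clinear) : f =1 g -> f = g.
Proof. by move=> fg; apply: val_inj; apply/funext. Qed.

Lemma clinearDE (f g : clinear) x : (f + g) x = f x + g x.
Proof. by []. Qed.

Lemma clinearZE (a : R) (f : clinear) x : (a *: f) x = a *: f x.
Proof. by []. Qed.

Lemma clinear0E x : (0 : clinear) x = 0.
Proof. by []. Qed.

Definition opnorm (f : clinear) : R := sup [set `|f x| | x in [set x | `|x| <= 1]].

Let ballimg (f : clinear) := [set `|f x| | x in [set x : E | `|x| <= 1]].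

Let ballimg_has_sup f : has_sup (ballimg f).
Proof.
split; first by exists `|f 0|, 0 => //=; rewrite normr0.
have /linear_bounded_continuous/linear_boundedP := @clinear_continuous f.
move=> /pinfty_ex_gt0[r r0 fr]; exists r => _ [x /= x1 <-].
by rewrite (le_trans (fr x))// ler_piMr// ltW.
Qed.

Let opnorm_ub (f : clinear) x : `|x| <= 1 -> `|f x| <= opnorm f.
Proof.
by move=> x1; apply: ub_le_sup; [case: (ballimg_has_sup f)|exists x].
Qed.

Let opnorm_le (f : clinear) M :
  (forall x, `|x| <= 1 -> `|f x| <= M) -> opnorm f <= M.
Proof.
move=> fM; apply: ge_sup; first by case: (ballimg_has_sup f).
by move=> _ [x x1 <-]; exact: fM.
Qed.

Let opnorm_ge0 (f : clinear) : 0 <= opnorm f.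
Proof. by rewrite (le_trans _ (@opnorm_ub f 0 _)) ?normr0. Qed.

Lemma le_opnorm (f : clinear) x : `|f x| <= opnorm f * `|x|.
Proof.
have [->|x0] := eqVneq x 0; first by rewrite linear0 !normr0 mulr0.
have nx : 0 < `|x| by rewrite normr_gt0.
have /(@opnorm_ub f) : `| `|x|^-1 *: x | <= 1.
  by rewrite normrZ normfV normr_id mulVf ?gt_eqF.
by rewrite linearZ/= normrZ normfV normr_id mulrC ler_pdivrMr.
Qed.

Lemma opnormD f g : opnorm (f + g) <= opnorm f + opnorm g.
Proof.
apply: opnorm_le => x x1; rewrite clinearDE (le_trans (ler_normD _ _))//.
by rewrite lerD// opnorm_ub.
Qed.

Let opnormZ_le (a : R) f : opnorm (a *: f) <= `|a| * opnorm f.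
Proof.
by apply: opnorm_le => x x1; rewrite clinearZE normrZ ler_wpM2l// opnorm_ub.
Qed.

Lemma opnormZ (a : R) f : opnorm (a *: f) = `|a| * opnorm f.
Proof.
apply/eqP; rewrite eq_le opnormZ_le/=.
have [->|a0] := eqVneq a 0; first by rewrite normr0 mul0r opnorm_ge0.
rewrite -[in leLHS](scale1r f) -(mulVf a0) -scalerA -ler_pdivlMl ?normr_gt0//.
by rewrite -normfV opnormZ_le.
Qed.

Lemma opnorm0_eq0 f : opnorm f = 0 -> f = 0.
Proof.
move=> f0; apply: clinearP => x; rewrite clinear0E; apply/normr0_eq0/le_anti.
by rewrite normr_ge0 andbT (le_trans (le_opnorm f x))// f0 mul0r.
Qed.

HB.instance Definition _ :=
  Lmodule_isNormed.Build R clinear opnormD opnormZ opnorm0_eq0.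

End clinear_def.
Arguments clinear {R} E F.

(* [Df : E -> clinear E F] is constrained on [U] only, where it is the
   Frechet derivative of [f]; the values of [f] outside [U] are irrelevant
   when [U] is open. *)
Fixpoint Ck {R : realType} (k : nat) {E F : normedModType R}
    (U : set E) (f : E -> F) : Prop :=
  match k with
  | 0 => forall x, U x -> {for x, continuous f}
  | k'.+1 => exists Df : E -> clinear E F,
      (forall x, U x -> is_diff x f (Df x)) /\ Ck k' U Df
  end.

Definition Cinfty {R : realType} {E F : normedModType R}
    (U : set E) (f : E -> F) : Prop :=
  forall k, Ck k U f.

(* A homeomorphism from an open subset of [T] onto an open subset of [E]; both
   maps are total functions whose values outside these sets are irrelevant. *)
Record chart {R : realType} (T : topologicalType) (E : normedModType R) :=
  Chart {
    chart_dom : set T;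
    chart_fun :> T -> E;
    chart_inv : E -> T;
    chart_dom_open : open chart_dom;
    chart_img_open : open (chart_fun @` chart_dom);
    chart_funK : forall x, chart_dom x -> chart_inv (chart_fun x) = x;
    chart_fun_cts : forall x, chart_dom x -> {for x, continuous chart_fun};
    chart_inv_cts : forall y, (chart_fun @` chart_dom) y ->
      {for y, continuous chart_inv}
  }.

(* The model space is allowed to depend on the chart. *)
Record smooth_atlas {R : realType} (T : topologicalType) (I : Type)
    (E : I -> normedModType R) := SmoothAtlas {
  atlas_chart : forall i, chart T (E i);
  atlas_cover : forall x, exists i, chart_dom (atlas_chart i) x;
  atlas_compat : forall i j,
    Cinfty
      (atlas_chart i @`
        (chart_dom (atlas_chart i) `&` chart_dom (atlas_chart j)))
      (atlas_chart j \o chart_inv (atlas_chart i))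
}.

(* A smooth structure is determined by any one of its atlases; [T] carries its
   given topology. *)
Definition smooth_manifold (R : realType) (n : nat) (M : topologicalType) :
    Prop :=
  hausdorff_space M /\
  exists I : Type, inhabited (smooth_atlas M (fun _ : I => 'rV[R]_n)).

Definition Banach_manifold (R : realType) (T : topologicalType) : Prop :=
  hausdorff_space T /\
  exists (I : Type) (E : I -> completeNormedModType R),
    inhabited (smooth_atlas T E).

Section mapping_space.
Import ArrowAsCompactOpen.

Definition mapping_space (A M : topologicalType) : topologicalType :=
  continuousType A M.

End mapping_space.

(* Main.v *)
Require Import Defs.
From HB Require Import structures.
From mathcomp Require Import all_boot all_order all_algebra.
From mathcomp Require Import all_classical all_reals all_analysis.
From mathcomp Require Import ring lra.
Set Implicit Arguments.
Unset Strict Implicit.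
Unset Printing Implicit Defensive.
Import Order.TTheory GRing.Theory Num.Theory.
Import numFieldNormedType.Exports.
Local Open Scope classical_set_scope.
Local Open Scope ring_scope.

(** Around a continuous map [f0 : A -> M] the space of continuous maps is modelled
on the Banach space of continuous tangent vector fields along [f0]: a map [f]
near [f0] corresponds to the field of displacements from [f0 a] to [f a].

Displacements are built without an exponential map. In a chart [phi_i] the
displacement from [x] to [y] is [phi_i y - phi_i x], which the differential of
a transition map carries to any other chart; [displacement] averages these
vectors with the weights of a partition of unity on [A]. At [y = x] all of them
have the differential of the identity, hence so has their average. Only
smoothness in [y] matters, so a continuous partition of unity on [A] is enough.

The inversion takes place in the space of all bounded functions, where a map
[f] is represented by its [coordinates], the function
[(a, j) |-> phi_j (f a)]. There displacement acts pointwise, and such an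
operator is smooth ([nemytskii_Ck]) because the transition maps are smooth near
compact sets. Its differential at the coordinates of [f0] is the identity, so
the Banach space [inverse_function] theorem applies. A function [w] obtained by
inversion from a tangent field need not, a priori, consist of coordinates of a
continuous map. It does ([tangent_section]): the displacement commutes with
changes of chart, so injectivity forces the values of [w] in different charts
to match, and the pointwise expansion estimate [displacement_expand] carries
continuity over from the field to [w].

On maps that send each of finitely many closed pieces of [A] into a chart
domain, the compact-open topology is that of uniform convergence of
coordinates ([chart_near_unif], [chart_near_open]); so displacement is a
homeomorphism from a neighborhood of [f0] onto an open set of tangent fields.
A change from one such chart to another is the composite of a local inverse, a
change of coordinates, which is again a composition operator, and a
displacement operator. This composite is smooth with values in bounded
functions, and it remains smooth as a map into the closed subspace of tangent
fields, by [Ck_descend]. *)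

(** * Banach spaces of bounded functions and closed submodules *)

HB.instance Definition _ (R : realType) (m n : nat) :=
  Uniform_isComplete.Build 'M[R]_(m, n) (@mx_complete R m n).

Section bounded_functions.
Context {R : realType} {X : Type} {V : normedModType R}.

Definition bfun_pred : {pred X -> V} :=
  [pred f : X -> V | `[< exists M, forall x, `|f x| <= M >]].

Record bfun := Bfun {
  bfun_fun :> X -> V;
  bfun_funP : bfun_fun \in bfun_pred }.

HB.instance Definition _ := [isSub for bfun_fun].
HB.instance Definition _ := [Choice of bfun by <:].

Lemma bfun_submod_closed : submod_closed bfun_pred.
Proof.
split; first by apply/asboolP; exists 0 => x; rewrite normr0.
move=> a f g /asboolP[M fM] /asboolP[N gN]; apply/asboolP.
exists (`|a| * M + N) => x; rewrite (le_trans (ler_normD _ _))// lerD//.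
by rewrite normrZ ler_wpM2l.
Qed.

HB.instance Definition _ :=
  GRing.isSubmodClosed.Build R (X -> V) bfun_pred bfun_submod_closed.
HB.instance Definition _ := [SubChoice_isSubLmodule of bfun by <:].

Lemma bfunP (f g : bfun) : f =1 g -> f = g.
Proof. by move=> fg; apply: val_inj; apply/funext. Qed.

Lemma bfunDE (f g : bfun) x : (f + g) x = f x + g x. Proof. by []. Qed.
Lemma bfunNE (f : bfun) x : (- f) x = - f x. Proof. by []. Qed.
Lemma bfunBE (f g : bfun) x : (f - g) x = f x - g x. Proof. by []. Qed.
Lemma bfunZE (a : R) (f : bfun) x : (a *: f) x = a *: f x. Proof. by []. Qed.

Definition bnorm (f : bfun) : R := sup (range (fun x => `|f x|)).

Let bnorm_ub (f : bfun) x : `|f x| <= bnorm f.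
Proof.
apply: ub_le_sup; last by exists x.
by have /asboolP[M fM] := bfun_funP f; exists M => _ [y _ <-].
Qed.

Let bnorm_le (f : bfun) M : 0 <= M -> (forall x, `|f x| <= M) -> bnorm f <= M.
Proof.
move=> M0 fM; have [[x _]|X0] := pselect (exists x : X, True).
  by apply: ge_sup; [exists `|f x|, x|move=> _ [y _ <-]].
suff X00 : range (fun x => `|f x|) = set0 by rewrite /bnorm X00 sup0.
by apply/seteqP; split => // y [x]; case: X0; exists x.
Qed.

Let bnorm_ge0 (f : bfun) : 0 <= bnorm f.
Proof.
have [[x _]|X0] := pselect (exists x : X, True).
  by rewrite (le_trans _ (bnorm_ub f x)).
suff X00 : range (fun x => `|f x|) = set0 by rewrite /bnorm X00 sup0.
by apply/seteqP; split => // y [x]; case: X0; exists x.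
Qed.

Let bnormD f g : bnorm (f + g) <= bnorm f + bnorm g.
Proof.
apply: bnorm_le => [|x]; first by rewrite addr_ge0.
by rewrite (le_trans (ler_normD _ _))// lerD.
Qed.

Let bnormZ_le (a : R) f : bnorm (a *: f) <= `|a| * bnorm f.
Proof.
by apply: bnorm_le => [|x]; [rewrite mulr_ge0|rewrite normrZ ler_wpM2l].
Qed.

Let bnormZ (a : R) f : bnorm (a *: f) = `|a| * bnorm f.
Proof.
apply/eqP; rewrite eq_le bnormZ_le/=.
have [->|a0] := eqVneq a 0; first by rewrite normr0 mul0r.
rewrite -[in leLHS](scale1r f) -(mulVf a0) -scalerA -ler_pdivlMl ?normr_gt0//.
by rewrite -normfV bnormZ_le.
Qed.

Let bnorm0_eq0 f : bnorm f = 0 -> f = 0.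
Proof.
move=> f0; apply: bfunP => x; apply/normr0_eq0/le_anti.
by rewrite normr_ge0 andbT -f0 bnorm_ub.
Qed.

HB.instance Definition _ :=
  Lmodule_isNormed.Build R bfun bnormD bnormZ bnorm0_eq0.

Lemma bfun_le (f : bfun) x : `|f x| <= `|f|. Proof. exact: bnorm_ub. Qed.

Lemma bfun_normP (f : bfun) M : 0 <= M ->
  `|f| <= M <-> forall x, `|f x| <= M.
Proof.
by move=> M0; split=> [fM x|]; [rewrite (le_trans (bfun_le _ _))|exact: bnorm_le].
Qed.

(** Zero stands for an unbounded function, so that operators on bounded functions
can be defined by formulas valid on part of their domain. *)
Definition mkbfun (f : X -> V) : bfun := insubd 0 f.

Lemma mkbfunE (f : X -> V) M : (forall x, `|f x| <= M) -> mkbfun f = f :> (X -> V).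
Proof. by move=> fM; apply: (@insubdK _ _ bfun); apply/asboolP; exists M. Qed.

End bounded_functions.
Arguments bfun {R} X V.

Section bounded_functions_complete.
Context {R : realType} {X : Type} {V : completeNormedModType R}.

Lemma bfun_complete (F : set_system (bfun X V)) :
  ProperFilter F -> cauchy F -> cvg F.
Proof.
move=> FF /cauchyP Fc.
have Fcx x : cvg ((fun f : bfun X V => f x) @ F).
  apply: cauchy_cvg; apply/cauchyP => e /Fc[g Fg]; exists (g x).
  suff : F [set f | ball (g x) e (f x)] by [].
  apply: filterS Fg => f; rewrite /= -!ball_normE/=.
  by apply: le_lt_trans; exact: (bfun_le (g - f)).
pose l x := lim ((fun f : bfun X V => f x) @ F).
have lP e : 0 < e -> exists2 g, F (ball g e) & forall x, `|g x - l x| <= e.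
  move=> e0; have [g Fg] := Fc e e0; exists g => // x.
  have gl : (fun f : bfun X V => `|g x - f x|) @ F --> `|g x - l x|.
    by apply: cvg_norm; apply: cvgB; [exact: cvg_cst|exact: Fcx].
  apply: (cvgr_to_le gl); apply: filterS Fg => f; rewrite -ball_normE/= => /ltW.
  by move=> gf; apply: le_trans gf; rewrite -bfunBE bfun_le.
have [M lM] : exists M, forall x, `|l x| <= M.
  have [g _ gl] := lP 1 ltr01; exists (`|g| + 1) => x.
  rewrite -[l x](subrK (g x)) addrC (le_trans (ler_normD _ _))// lerD ?bfun_le//.
  by rewrite distrC.
apply/cvg_ex; exists (mkbfun l); apply/cvgrPdist_le => e e0.
have e20 : 0 < e / 2 by rewrite divr_gt0.
have [g Fg gl] := lP _ e20; apply: filterS Fg => f.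
rewrite -ball_normE/= => /ltW gf; apply/bfun_normP; first exact: ltW.
move=> x; rewrite bfunBE (mkbfunE lM) -(subrK (g x) (l x)) -addrA.
rewrite (le_trans (ler_normD _ _))// [e]splitr lerD// 1?distrC//.
by rewrite distrC (le_trans _ gf)// (bfun_le (g - f)).
Qed.

HB.instance Definition _ := Uniform_isComplete.Build (bfun X V) bfun_complete.
End bounded_functions_complete.

(** The model spaces are subspaces of spaces of bounded functions; they become types
here because a chart takes values in a normed module, not in a subset of one. *)
Record closed_submodule {R : realType} (Z : normedModType R) := ClosedSubmodule {
  csub_pred : {pred Z};
  csub_submod : submod_closed csub_pred;
  csub_closed : closed [set x | x \in csub_pred] }.

Section closed_submodule_type.
Context {R : realType} {Z : normedModType R} (S : closed_submodule Z).

Record csub := Csub {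
  csub_val :> Z;
  csub_valP : csub_val \in csub_pred S }.

HB.instance Definition _ := [isSub for csub_val].
HB.instance Definition _ := [Choice of csub by <:].
HB.instance Definition _ :=
  GRing.isSubmodClosed.Build R Z (csub_pred S) (csub_submod S).
HB.instance Definition _ := [SubChoice_isSubLmodule of csub by <:].

Let cnorm (x : csub) : R := `|x : Z|.
Let cnormD x y : cnorm (x + y) <= cnorm x + cnorm y.
Proof. exact: ler_normD. Qed.
Let cnormZ (a : R) x : cnorm (a *: x) = `|a| * cnorm x.
Proof. exact: normrZ. Qed.
Let cnorm0_eq0 x : cnorm x = 0 -> x = 0.
Proof. by move=> /normr0_eq0 x0; apply: val_inj. Qed.

HB.instance Definition _ :=
  Lmodule_isNormed.Build R csub cnormD cnormZ cnorm0_eq0.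

End closed_submodule_type.
Arguments csub {R Z} S.
Arguments csub_val {R Z S} c.

Section closed_submodule_complete.
Context {R : realType} {Z : completeNormedModType R} (S : closed_submodule Z).

Lemma csub_complete (F : set_system (csub S)) :
  ProperFilter F -> cauchy F -> cvg F.
Proof.
move=> FF /cauchyP Fc.
have Fl : cvg ((csub_val : csub S -> Z) @ F).
  apply: cauchy_cvg; apply/cauchyP => e /Fc[g Fg]; exists (csub_val (g : csub S)).
  suff : F [set f | ball (csub_val (g : csub S)) e (csub_val f)] by [].
  by apply: filterS Fg => f; rewrite -!ball_normE.
pose l := lim ((csub_val : csub S -> Z) @ F).
have lS : l \in csub_pred S.
  have := @closed_cvg _ _ F _ csub_val (fun x : Z => x \in csub_pred S) (csub_closed (c:=S)).
  by apply => //; apply: nearW => x; exact: csub_valP.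
apply/cvg_ex; exists (Csub lS); apply/cvgrPdist_le => e e0.
by move/cvgrPdist_le : Fl => /(_ e e0).
Qed.

HB.instance Definition _ := Uniform_isComplete.Build (csub S) csub_complete.
End closed_submodule_complete.


(** * Spaces of continuous linear maps *)

Section clinear_constructions.
Context {R : realType}.
Implicit Types E F G H : normedModType R.

Lemma opnorm_le_bound E F (f : clinear E F) M : 0 <= M ->
  (forall x, `|f x| <= M * `|x|) -> `|f| <= M.
Proof.
move=> M0 fM; apply: ge_sup; first by exists `|f 0|, 0 => //=; rewrite normr0.
by move=> _ [x /= x1 <-]; rewrite (le_trans (fM x))// ler_piMr.
Qed.

Lemma clinear_le E F (f : clinear E F) x : `|f x| <= `|f| * `|x|.
Proof. exact: le_opnorm. Qed.

Lemma clinear_boundP E F (f : E -> F) M : linear f ->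
  (forall x, `|f x| <= M * `|x|) -> f \in @clinear_pred R E F.
Proof.
move=> lf fM; apply/asboolP; split => //.
pose g : {linear E -> F} := HB.pack f (GRing.isLinear.Build R E F *:%R f lf).
apply: (@bounded_linear_continuous _ _ _ g); apply/linear_boundedP.
near=> N => x; rewrite (le_trans (fM x))// ler_wpM2r//.
Unshelve. all: end_near. Qed.

(** All later arguments about differentials are estimates, in this form. *)
Lemma is_diffP E F (f : E -> F) (x : E) (T : clinear E F) :
  is_diff x f T <->
  forall e, 0 < e -> \forall h \near 0, `|f (x + h) - f x - T h| <= e * `|h|.
Proof.
split=> [[df dfT] e e0|fT].
  have /diff_locally := df; rewrite dfT => /eqaddoP/(_ e e0).
  apply: filterS => h; by rewrite /= !fctE/= /shift/= opprD addrA (addrC h).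
have fTo : f \o shift x = cst (f x) + (T : E -> F) +o_ 0 id.
  apply/eqaddoP => e /fT; apply: filterS => h; by rewrite /= !fctE/= /shift/= opprD addrA (addrC h).
have dfT := diff_unique (@clinear_continuous _ _ _ T) fTo.
split => //; apply/diff_locallyP; rewrite dfT; split => //.
exact: clinear_continuous.
Qed.

Definition mkclinear E F (f : E -> F) (lf : linear f) M
  (fM : forall x, `|f x| <= M * `|x|) : clinear E F :=
  Clinear (clinear_boundP lf fM).

Section bilinear_maps.
Variables (F G H : normedModType R) (b : F -> G -> H) (M : R).
Hypotheses (b1 : forall y, linear (b^~ y)) (b2 : forall x, linear (b x)).
Hypothesis (bM : forall x y, `|b x y| <= M * `|x| * `|y|).

Let bx x : clinear G H := mkclinear (b2 x) (bM x).

Let bx_linear : linear bx.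
Proof. by move=> a x y; apply: clinearP => z; exact: b1. Qed.

Let bx_bound x : `|bx x| <= `|M| * `|x|.
Proof.
apply: opnorm_le_bound => [|y]; first by rewrite mulr_ge0.
by rewrite (le_trans (bM x y))// -!mulrA ler_wpM2r ?ler_norm// mulr_ge0.
Qed.

Definition mkbilinear : clinear F (clinear G H) := mkclinear bx_linear bx_bound.

End bilinear_maps.

Let comp_linear E F G (L : clinear F G) (T : clinear E F) : linear (L \o T).
Proof. by move=> a x y /=; rewrite !linearP. Qed.

Let comp_bound E F G (L : clinear F G) (T : clinear E F) x :
  `|(L \o T) x| <= `|L| * `|T| * `|x|.
Proof.
by rewrite (le_trans (clinear_le L _))// -mulrA ler_wpM2l// clinear_le.
Qed.

Definition clinear_comp E F G (L : clinear F G) (T : clinear E F) : clinear E G :=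
  mkclinear (comp_linear L T) (comp_bound L T).

Lemma clinear_compE E F G (L : clinear F G) (T : clinear E F) x :
  clinear_comp L T x = L (T x).
Proof. by []. Qed.

Lemma clinear_comp_le E F G (L : clinear F G) (T : clinear E F) :
  `|clinear_comp L T| <= `|L| * `|T|.
Proof.
apply: opnorm_le_bound => [|x]; first by rewrite mulr_ge0.
exact: comp_bound.
Qed.

Let id_bound E (x : E) : `|idfun x| <= 1 * `|x|.
Proof. by rewrite mul1r. Qed.

Let id_linear E : linear (@idfun E). Proof. by []. Qed.

Definition clinear_id E : clinear E E := mkclinear (@id_linear E) (@id_bound E).

Lemma clinear_idE E (x : E) : clinear_id E x = x. Proof. by []. Qed.

(** Composition, its argument swap [flip] and the product rule are stated as bounded
bilinear maps: the derivative of a composite is then a bilinear expression in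
maps of lower order, to which an induction on the order applies. *)
Definition compose E F G :
  clinear (clinear F G) (clinear (clinear E F) (clinear E G)).
Proof.
apply: (@mkbilinear _ _ _ (@clinear_comp E F G) 1).
- by move=> T a L L'; apply: clinearP.
- by move=> L a T T'; apply: clinearP => x; exact: linearP.
- by move=> L T; rewrite mul1r; exact: clinear_comp_le.
Defined.

Lemma composeE E F G (L : clinear F G) (T : clinear E F) x :
  compose E F G L T x = L (T x).
Proof. by []. Qed.

Definition swap_arg E F G (T : clinear E (clinear F G)) : clinear F (clinear E G).
Proof.
apply: (@mkbilinear _ _ _ (fun y x => T x y) `|T|).
- by move=> x a y z; rewrite linearP.
- by move=> y a x z; rewrite linearP.
- move=> y x; rewrite (le_trans (clinear_le (T x) y))// mulrAC.
  by rewrite ler_wpM2r// clinear_le.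
Defined.

Lemma swap_argE E F G (T : clinear E (clinear F G)) y x : swap_arg T y x = T x y.
Proof. by []. Qed.

Lemma swap_arg_le E F G (T : clinear E (clinear F G)) : `|swap_arg T| <= `|T|.
Proof.
apply: opnorm_le_bound => // y; apply: opnorm_le_bound => [|x].
  by rewrite mulr_ge0.
rewrite swap_argE (le_trans (clinear_le (T x) y))// mulrAC.
by rewrite ler_wpM2r// clinear_le.
Qed.

Definition flip E F G :
  clinear (clinear E (clinear F G)) (clinear F (clinear E G)).
Proof.
apply: (@mkclinear _ _ (@swap_arg E F G) _ 1).
- by move=> a T T'; apply: clinearP => y; apply: clinearP => x.
- by move=> T; rewrite mul1r; exact: swap_arg_le.
Defined.

Lemma flipE E F G T y x : flip E F G T y x = T x y. Proof. by []. Qed.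

End clinear_constructions.

(** * Rules for the differential *)

Section differentials.
Context {R : realType}.
Implicit Types E F G H : normedModType R.

Lemma is_diff_uniq E F (f : E -> F) x (T S : clinear E F) :
  is_diff x f T -> is_diff x f S -> T = S.
Proof. by move=> [_ fT] [_ fS]; apply: clinearP => h; rewrite -fT -fS. Qed.

Lemma is_diff_near E F (f g : E -> F) x (T : clinear E F) :
  (\forall y \near x, f y = g y) -> is_diff x f T -> is_diff x g T.
Proof.
move=> fg /is_diffP fT; apply/is_diffP => e /fT fe.
have fg0 : \forall h \near (0 : E), f (x + h) = g (x + h).
  by move: fg; rewrite (near_shift 0) /= subr0; apply: filterS => h /=; rewrite addrC.
rewrite -(nbhs_singleton fg).
by apply: filter_app fe; apply: filterS fg0 => h ->.
Qed.

Lemma is_diff_cts E F (f : E -> F) x (T : clinear E F) :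
  is_diff x f T -> {for x, continuous f}.
Proof. by move=> [df _]; exact: differentiable_continuous. Qed.

Lemma is_diff_clinear E F (T : clinear E F) x : is_diff x T T.
Proof.
apply/is_diffP => e e0; apply: nearW => h.
by rewrite linearD addrAC addrK subrr normr0 mulr_ge0// ltW.
Qed.

Lemma is_diff_cst E F (c : F) (x : E) : is_diff x (fun=> c) (0 : clinear E F).
Proof.
apply/is_diffP => e e0; apply: nearW => h.
by rewrite clinear0E !subrr normr0 mulr_ge0// ltW.
Qed.

Lemma is_diff_add E F (f g : E -> F) x (T S : clinear E F) :
  is_diff x f T -> is_diff x g S -> is_diff x (fun y => f y + g y) (T + S).
Proof.
move=> /is_diffP fT /is_diffP gS; apply/is_diffP => e e0.
have e20 : 0 < e / 2 by rewrite divr_gt0.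
apply: filter_app (fT _ e20); apply: filterS (gS _ e20) => h hS hT.
rewrite clinearDE.
have -> : f (x + h) + g (x + h) - (f x + g x) - (T h + S h) =
  (f (x + h) - f x - T h) + (g (x + h) - g x - S h).
  by rewrite !opprD [RHS]addrACA [X in _ = X + _]addrACA.
by rewrite (le_trans (ler_normD _ _))// [e]splitr mulrDl lerD.
Qed.

(** The form in which the chain and product rules and the mean value inequality
use the remainder. *)
Lemma is_diff_lip E F (f : E -> F) x (T : clinear E F) e : 0 < e ->
  is_diff x f T ->
  \forall h \near (0 : E), `|f (x + h) - f x| <= (`|T| + e) * `|h|.
Proof.
move=> e0 /is_diffP/(_ e e0); apply: filterS => h fh.
rewrite -[f _ - _](subrK (T h)) (le_trans (ler_normD _ _))// addrC mulrDl.
by rewrite lerD// clinear_le.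
Qed.

Lemma is_diff_comp E F G (f : E -> F) (g : F -> G) x
    (T : clinear E F) (S : clinear F G) :
  is_diff x f T -> is_diff (f x) g S -> is_diff x (g \o f) (clinear_comp S T).
Proof.
move=> df dg; have cf := is_diff_cts df; have lf := is_diff_lip ltr01 df.
move/is_diffP : df => df; move/is_diffP : dg => dg; apply/is_diffP => e e0.
pose K := `|T| + 1; have K0 : 0 < K by rewrite ltr_wpDl.
have e2_ge0 : 0 <= e / 2 by rewrite divr_ge0// ltW.
pose e1 := e / 2 / K; have e10 : 0 < e1 by rewrite !divr_gt0.
pose e2 := e / 2 / (`|S| + 1).
have S0 : 0 < `|S| + 1 by rewrite ltr_wpDl.
have e20 : 0 < e2 by rewrite !divr_gt0.
have gf : \forall h \near (0 : E),
    `|g (f (x + h)) - g (f x) - S (f (x + h) - f x)| <= e1 * `|f (x + h) - f x|.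
  have c0 : (fun h : E => f (x + h) - f x) @ (0 : E) --> (0 : F).
    rewrite -(subrr (f x)); apply: cvgB; last exact: cvg_cst.
    have xh : (fun h : E => x + h) @ (0 : E) --> x.
      by rewrite -[X in _ --> X]addr0; apply: cvgD; [exact: cvg_cst|exact: cvg_id].
    exact: (cvg_comp _ _ xh cf).
  have := c0 _ (dg _ e10); rewrite /= nbhs_simpl/=; apply: filterS => h.
  by rewrite /= [f x + _]addrC subrK.
apply: filter_app gf; apply: filter_app lf; apply: filterS (df _ e20) => h hf hl hg.
rewrite clinear_compE /=.
have -> : g (f (x + h)) - g (f x) - S (T h) =
   (g (f (x + h)) - g (f x) - S (f (x + h) - f x)) + S (f (x + h) - f x - T h).
  by rewrite [S (_ - T h)]linearB addrA subrK.
rewrite (le_trans (ler_normD _ _))// [e]splitr mulrDl lerD//.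
- rewrite (le_trans hg)// /e1 -(mulrA (e / 2)) ler_wpM2l//.
  by rewrite ler_pdivrMl.
- rewrite (le_trans (clinear_le S _))//.
  rewrite (le_trans (ler_wpM2l _ hf))// mulrA ler_wpM2r// /e2 mulrCA.
  by rewrite ler_piMr// ler_pdivrMr// mul1r lerDl.
Qed.

(** Beyond the two linear terms the increment contains [b] applied to both
increments, which is of second order because each is [O(h)]. *)
Lemma is_diff_bilinear E F G H (b : clinear F (clinear G H))
    (f : E -> F) (g : E -> G) x (T : clinear E F) (S : clinear E G) :
  is_diff x f T -> is_diff x g S ->
  is_diff x (fun y => b (f y) (g y))
    (flip _ _ _ (clinear_comp b T) (g x) + clinear_comp (b (f x)) S).
Proof.
move=> df dg; have lf := is_diff_lip ltr01 df; have lg := is_diff_lip ltr01 dg.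
have cg := is_diff_cts dg.
move/is_diffP : df => df; move/is_diffP : dg => dg; apply/is_diffP => e e0.
pose N := `|g x| + 1; have N0 : 0 < N by rewrite ltr_wpDl.
pose P := `|f x| + 1; have P0 : 0 < P by rewrite ltr_wpDl.
pose B := `|b| + 1; have B0 : 0 < B by rewrite ltr_wpDl.
pose KT := `|T| + 1; have KT0 : 0 < KT by rewrite ltr_wpDl.
pose KS := `|S| + 1; have KS0 : 0 < KS by rewrite ltr_wpDl.
have e30 : 0 < e / 3 by rewrite divr_gt0.
pose e1 := e / 3 / (B * N); have e10 : 0 < e1 by rewrite !divr_gt0// mulr_gt0.
pose e2 := e / 3 / (B * P); have e20 : 0 < e2 by rewrite !divr_gt0// mulr_gt0.
pose d := e / 3 / (B * (KT * KS)).
have d0 : 0 < d by rewrite !divr_gt0// !mulr_gt0.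
have hd : \forall h \near (0 : E), `|h| <= d.
  by apply: cvgr0_norm_le => //; exact: cvg_id.
have bB u v : `|b u v| <= B * (`|u| * `|v|).
  rewrite (le_trans (clinear_le (b u) v))// mulrA ler_wpM2r//.
  by rewrite (le_trans (clinear_le b u))// ler_wpM2r// lerDl.
apply: filter_app hd; apply: filter_app lf; apply: filter_app lg.
apply: filter_app (df _ e10); apply: filterS (dg _ e20) => h hg hf lg lf hd.
rewrite clinearDE flipE !clinear_compE.
set u := f (x + h) - f x; set v := g (x + h) - g x.
have -> : b (f (x + h)) (g (x + h)) - b (f x) (g x)
    - (b (T h) (g x) + b (f x) (S h)) =
  b u v + (b (u - T h) (g x) + b (f x) (v - S h)).
  (* the bilinear remainder, with all increments abstracted *)
  have key p q w z t s : b (w + p) (z + q) - b p q - (b t q + b p s) =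
      b w z + (b (w - t) q + b p (z - s)).
    have bDl p1 q1 r : b (p1 + q1) r = b p1 r + b q1 r by rewrite linearD.
    have bDr r p1 q1 : b r (p1 + q1) = b r p1 + b r q1 by rewrite linearD.
    have bNl p1 r : b (- p1) r = - b p1 r by rewrite linearN.
    have bNr p1 r : b r (- p1) = - b r p1 by rewrite linearN.
    rewrite !bDl !bDr bNl bNr opprD !addrA addrK.
    by rewrite [LHS](ACl (1*2*4*3*5)).
  by rewrite -key !subrK.
have -> : e = e / 3 + (e / 3 + e / 3) by field.
rewrite (le_trans (ler_normD _ _))// !mulrDl lerD//; last first.
  rewrite (le_trans (ler_normD _ _))// lerD// (le_trans (bB _ _))//.
  - have -> : e / 3 * `|h| = B * (e1 * `|h| * N).
      by rewrite /e1; field; rewrite !gt_eqF.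
    by rewrite ler_wpM2l ?(ltW B0)// ler_pM// lerDl.
  - have -> : e / 3 * `|h| = B * (P * (e2 * `|h|)).
      by rewrite /e2; field; rewrite !gt_eqF.
    by rewrite ler_wpM2l ?(ltW B0)// ler_pM// lerDl.
rewrite (le_trans (bB _ _))//.
have -> : e / 3 * `|h| = B * (KT * `|h| * (KS * d)).
  by rewrite /d; field; rewrite !gt_eqF.
rewrite ler_wpM2l ?(ltW B0)// ler_pM// (le_trans lg)// ler_wpM2l// ltW.
Qed.
End differentials.

(** * Calculus of C^k maps *)

Section Ck_calculus.
Context {R : realType}.
Implicit Types E F G H : normedModType R.

Lemma Ck_continuous k E F (U : set E) (f : E -> F) :
  Ck k U f -> forall x, U x -> {for x, continuous f}.
Proof.
case: k => [//|k] /= [Df [dDf _]] x Ux; exact: (is_diff_cts (dDf x Ux)).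
Qed.

Lemma Ck_subset k E F (U W : set E) (f : E -> F) :
  W `<=` U -> Ck k U f -> Ck k W f.
Proof.
move=> WU; elim: k F f => [|k IH] F f /=; first by move=> cf x /WU; exact: cf.
by move=> [Df [dDf /IH CDf]]; exists Df; split => // x /WU; exact: dDf.
Qed.

Lemma Ck_congr k E F (U : set E) (f g : E -> F) : open U ->
  (forall x, U x -> f x = g x) -> Ck k U f -> Ck k U g.
Proof.
move=> oU fg.
have fg_near x : U x -> \forall y \near x, f y = g y.
  by move=> Ux; apply: filterS (open_nbhs_nbhs (conj oU Ux)) => y; exact: fg.
case: k => [cf x Ux|k [Df [dDf CDf]]].
  rewrite /prop_for /continuous_at -(fg _ Ux).
  apply: cvg_trans (cf x Ux); apply: near_eq_cvg.
  exact: fg_near.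
exists Df; split => // x Ux; apply: is_diff_near (dDf x Ux); exact: fg_near.
Qed.

Lemma Ck_pred k E F (U : set E) (f : E -> F) : Ck k.+1 U f -> Ck k U f.
Proof.
elim: k F f => [|k IH] F f [Df [dDf CDf]].
  by move=> x Ux; exact: (is_diff_cts (dDf x Ux)).
by exists Df; split => //; exact: IH.
Qed.

(** The differentials given on the members of a cover agree on overlaps, being
determined by the map, so they glue. *)
Lemma Ck_local k E F (U : set E) (f : E -> F) : open U ->
  (forall x, U x -> exists W, [/\ open W, W x & Ck k W f]) -> Ck k U f.
Proof.
move=> oU; elim: k F f => [|k IH] F f loc.
  by move=> x /loc[W [_ Wx cf]]; exact: cf.
have dex x : exists T : clinear E F, U x -> is_diff x f T.
  have [Ux|nUx] := pselect (U x); last by exists 0.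
  by have [W [_ Wx [Df [dDf _]]]] := loc x Ux; exists (Df x) => _; exact: dDf.
have [Df dDf] := choice dex.
exists Df; split=> //; apply: IH => x Ux.
have [W [oW Wx [Dg [dDg CDg]]]] := loc x Ux.
exists (W `&` U); split => //; first exact: openI.
apply: (@Ck_congr _ _ _ _ Dg); first exact: openI.
  by move=> y [Wy Uy]; exact: (is_diff_uniq (dDg y Wy) (dDf y Uy)).
by apply: Ck_subset CDg => y [].
Qed.

Lemma Ck_cst k E F (U : set E) (c : F) : Ck k U (fun=> c).
Proof.
elim: k F c => [|k IH] F c /=; first by move=> x _; exact: cvg_cst.
by exists (fun=> 0); split; [move=> x _; exact: is_diff_cst|exact: IH].
Qed.

Lemma Ck_clinear k E F (U : set E) (T : clinear E F) : Ck k U T.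
Proof.
case: k => [|k]; first by move=> x _; exact: clinear_continuous.
exists (fun=> T); split; [by move=> x _; exact: is_diff_clinear|exact: Ck_cst].
Qed.

Lemma Ck_add k E F (U : set E) (f g : E -> F) :
  Ck k U f -> Ck k U g -> Ck k U (fun x => f x + g x).
Proof.
elim: k F f g => [|k IH] F f g.
  by move=> cf cg x Ux; apply: cvgD; [exact: cf|exact: cg].
move=> [Df [dDf CDf]] [Dg [dDg CDg]].
exists (fun x => Df x + Dg x); split; last exact: IH.
by move=> x Ux; apply: is_diff_add; [exact: dDf|exact: dDg].
Qed.

Lemma Ck_sum k (I : Type) (r : seq I) E F (U : set E) (f : I -> E -> F) :
  (forall i, Ck k U (f i)) -> Ck k U (fun x => \sum_(i <- r) f i x).
Proof.
move=> Cf; elim: r => [|i r IH].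
  by under [X in Ck _ _ X]eq_fun do rewrite big_nil; exact: Ck_cst.
by under [X in Ck _ _ X]eq_fun do rewrite big_cons; exact: Ck_add.
Qed.

Lemma Ck_postcomp k E F G (U : set E) (L : clinear F G) (f : E -> F) :
  Ck k U f -> Ck k U (fun x => L (f x)).
Proof.
elim: k F G L f => [|k IH] F G L f.
  move=> cf x Ux; apply: (cvg_comp _ _ (cf x Ux)); exact: clinear_continuous.
move=> [Df [dDf CDf]]; exists (fun x => compose E F G L (Df x)); split.
  by move=> x Ux; apply: (is_diff_comp (dDf x Ux)); exact: is_diff_clinear.
exact: IH.
Qed.

Lemma cvg_clinear_app (T : Type) (A : set_system T) E F
    (L : T -> clinear E F) (v : T -> E) (L0 : clinear E F) (v0 : E) :
  Filter A -> L @ A --> L0 -> v @ A --> v0 -> (fun t => L t (v t)) @ A --> L0 v0.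
Proof.
move=> FA LL0 vv0.
have -> : (fun t => L t (v t)) = (fun t => (L t - L0) (v t) + L0 (v t)).
  by apply/funext => t; rewrite -[(L t - L0) _]/(L t (v t) - L0 (v t)) subrK.
rewrite -[X in _ --> X]add0r; apply: cvgD; last first.
  by apply: (cvg_comp _ _ vv0); exact: clinear_continuous.
have zz : (fun t => `|L t - L0| * `|v t|) @ A --> (0 : R).
  rewrite -[X in _ --> X](mul0r `|v0|) -(@normr0 _ (clinear E F)) -(subrr L0).
  by apply: cvgM; apply: cvg_norm => //; apply: cvgB => //; exact: cvg_cst.
apply/cvgr0Pnorm_le => e e0; move/cvgr0Pnorm_le : zz => /(_ e e0).
apply: filterS => t; apply: le_trans.
by rewrite [leRHS]ger0_norm ?mulr_ge0// clinear_le.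
Qed.

(** The derivative is a sum of two bilinear expressions of the same kind, for other
bilinear maps; hence the quantification over [b] in the induction. *)
Lemma Ck_bilinear k E F G H (U : set E) (b : clinear F (clinear G H))
    (f : E -> F) (g : E -> G) :
  Ck k U f -> Ck k U g -> Ck k U (fun x => b (f x) (g x)).
Proof.
elim: k F G H b f g => [|k IH] F G H b f g.
  move=> cf cg x Ux; apply: cvg_clinear_app; last exact: cg.
  by apply: (cvg_comp _ _ (cf x Ux)); exact: clinear_continuous.
move=> Cf Cg; have [Df [dDf CDf]] := Cf; have [Dg [dDg CDg]] := Cg.
exists (fun x => clinear_comp (flip E G H) (compose E F _ b) (Df x) (g x)
   + clinear_comp (compose E G H) b (f x) (Dg x)); split.
  by move=> x Ux; apply: is_diff_bilinear; [exact: dDf|exact: dDg].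
by apply: Ck_add; apply: IH => //; exact: Ck_pred.
Qed.

(** By the chain rule the derivative is [compose] applied to [Dg \o f] and [Df], so the
induction closes with the product rule. *)
Lemma Ck_comp k E F G (U : set E) (W : set F) (f : E -> F) (g : F -> G) :
  (forall x, U x -> W (f x)) -> Ck k U f -> Ck k W g -> Ck k U (g \o f).
Proof.
move=> fUW; elim: k G g => [|k IH] G g.
  move=> cf cg x Ux; apply: (cvg_comp _ _ (cf x Ux)); exact: cg (fUW _ Ux).
move=> Cf; have [Df [dDf CDf]] := Cf; move=> [Dg [dDg CDg]].
exists (fun x => compose E F G ((Dg \o f) x) (Df x)); split.
  by move=> x Ux; apply: (is_diff_comp (dDf x Ux)); exact: dDg (fUW _ Ux).
by apply: Ck_bilinear => //; apply: IH => //; exact: Ck_pred.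
Qed.

(** The derivative of the inverse is [S' = - S \o T' \o S], in which [S] itself
occurs, so that its order of smoothness can be raised one step at a time. The
uniform bound [M] turns continuity of [T] into that of [S]. *)
Lemma Ck_inverse_operator k E F G (U : set E) (T : E -> clinear F G)
    (S : E -> clinear G F) M : open U ->
  (forall x y, U x -> S x (T x y) = y) -> (forall x y, U x -> T x (S x y) = y) ->
  (forall x, U x -> `|S x| <= M) -> Ck k U T -> Ck k U S.
Proof.
move=> oU ST TS SM.
have Sdiff x y : U x -> U y ->
    S y - S x = - clinear_comp (S y) (clinear_comp (T y - T x) (S x)).
  move=> Ux Uy; apply: clinearP => z.
  rewrite -[RHS]/(- S y (T y (S x z) - T x (S x z))).
  by rewrite TS// linearB/= ST// opprB.
have normSTS x y (V : clinear F G) : U x -> U y ->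
    `|clinear_comp (S y) (clinear_comp V (S x))| <= M * (`|V| * M).
  move=> Ux Uy; rewrite (le_trans (clinear_comp_le _ _))// ler_pM//; first exact: SM.
  by rewrite (le_trans (clinear_comp_le _ _))// ler_wpM2l// SM.
have Scts : (forall x, U x -> {for x, continuous T}) ->
    forall x, U x -> {for x, continuous S}.
  move=> cT x Ux; apply/cvgrPdist_le => e e0.
  have M0 : 0 <= M by rewrite (le_trans _ (SM x Ux)).
  have K0 : 0 < M * M + 1 by rewrite ltr_wpDl// mulr_ge0.
  have eK : 0 < e / (M * M + 1) by rewrite divr_gt0.
  have /cvgrPdist_le/(_ _ eK) := cT x Ux.
  apply: filter_app; apply: filterS (open_nbhs_nbhs (conj oU Ux)) => y Uy Txy.
  rewrite distrC Sdiff// normrN (le_trans (normSTS _ _ _ _ _))//.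
  have -> : M * (`|T y - T x| * M) = `|T y - T x| * (M * M) by ring.
  rewrite (@le_trans _ _ (`|T y - T x| * (M * M + 1)))//.
    by rewrite ler_wpM2l// lerDl.
  by rewrite -ler_pdivlMr// distrC.
elim: k => [//|k IH] CT.
have CS := IH (Ck_pred CT); have [DT [dDT CDT]] := CT.
pose D x := compose E (clinear G G) (clinear G F) (compose G G F (S x))
  (compose E (clinear F G) (clinear G G) (flip _ _ _ (compose G F G) (S x)) (DT x)).
exists (fun x => - D x); split; last first.
  apply: (Ck_postcomp (- clinear_id _)).
  apply: (Ck_bilinear (compose E (clinear G G) (clinear G F))).
    exact: (Ck_postcomp (compose G G F)).
  apply: (Ck_bilinear (compose E (clinear F G) (clinear G G))) => //.
  exact: (Ck_postcomp (flip _ _ _ (compose G F G))).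
move=> x Ux; apply/is_diffP => e e0.
have M0 : 0 <= M by rewrite (le_trans _ (SM x Ux)).
pose K := `|DT x| + 1; have K0 : 0 < K by rewrite ltr_wpDl.
have e20 : 0 < e / 2 by rewrite divr_gt0.
pose d := e / 2 / (M * K * M * K * M + 1).
have MK0 : 0 < M * K * M * K * M + 1 by rewrite ltr_wpDl// !mulr_ge0// ltW.
have d0 : 0 < d by rewrite divr_gt0.
pose e1 := e / 2 / (M * M + 1).
have MM0 : 0 < M * M + 1 by rewrite ltr_wpDl// mulr_ge0.
have e10 : 0 < e1 by rewrite divr_gt0.
have hU : \forall h \near (0 : E), U (x + h).
  have : (fun h : E => x + h) @ (0 : E) --> x.
    by rewrite -[X in _ --> X]addr0; apply: cvgD; [exact: cvg_cst|exact: cvg_id].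
  by apply; exact: open_nbhs_nbhs.
have hd : \forall h \near (0 : E), `|h| <= d.
  by apply: cvgr0_norm_le => //; exact: cvg_id.
have lT := is_diff_lip ltr01 (dDT x Ux).
have /is_diffP/(_ _ e10) := dDT x Ux.
apply: filter_app; apply: filter_app lT; apply: filter_app hd.
apply: filterS hU => h Uxh hd lT hT.
pose V := T (x + h) - T x.
have -> : S (x + h) - S x - (- D x) h =
    - clinear_comp (S (x + h) - S x) (clinear_comp V (S x)) -
    clinear_comp (S x) (clinear_comp (V - DT x h) (S x)).
  rewrite [in LHS]Sdiff//; apply: clinearP => z.
  rewrite [LHS]/(- S (x + h) (V (S x z)) - (- S x (DT x h (S x z)))).
  rewrite [RHS]/(- (S (x + h) (V (S x z)) - S x (V (S x z)))
    - S x (V (S x z) - DT x h (S x z))).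
  by rewrite [S x (_ - DT x h _)]linearB/= !opprB opprK [RHS]addrC addrA subrK addrC.
rewrite (le_trans (ler_normB _ _))// normrN [e]splitr mulrDl lerD//.
  rewrite (le_trans (clinear_comp_le _ _))//.
  rewrite (@le_trans _ _ ((M * ((K * `|h|) * M)) * ((K * `|h|) * M)))//.
    rewrite ler_pM//.
      rewrite Sdiff// normrN (le_trans (normSTS _ _ _ _ _))//.
      by rewrite ler_wpM2l// ler_wpM2r.
    by rewrite (le_trans (clinear_comp_le _ _))// ler_pM// SM.
  have -> : M * (K * `|h| * M) * (K * `|h| * M) = (M * K * M * K * M * `|h|) * `|h|.
    by ring.
  rewrite ler_wpM2r// (@le_trans _ _ ((M * K * M * K * M + 1) * d))//.
    by rewrite ler_pM ?lerDl// !mulr_ge0// ltW.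
  by rewrite mulrC divfK ?gt_eqF.
rewrite (le_trans (normSTS _ _ _ _ _))//.
have -> : M * (`|V - DT x h| * M) = M * M * `|V - DT x h| by ring.
rewrite (@le_trans _ _ ((M * M + 1) * (e1 * `|h|)))//.
  by rewrite ler_pM// ?lerDl// mulr_ge0.
by rewrite mulrA ler_wpM2r// mulrC divfK ?gt_eqF.
Qed.
End Ck_calculus.

(** * Mean value inequality and maps close to the identity *)

Section mean_value.
Context {R : realType}.
Implicit Types E F : normedModType R.

(** Let [c] be the supremum of the times at which the bound holds. The local
estimate at [c] compares any time shortly after [c] with a time shortly before
it at which the bound holds; so the bound persists beyond [c] unless [c = 1]. *)
Lemma growth_bound F (phi : R -> F) (C : R) :
  (forall c : R, 0 <= c <= 1 -> exists2 d : R, 0 < d & forall t : R, 0 <= t <= 1 ->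
    `|t - c| < d -> `|phi t - phi c| <= C * `|t - c|) ->
  `|phi 1 - phi 0| <= C.
Proof.
move=> loc; pose A := [set t : R | 0 <= t <= 1 /\ `|phi t - phi 0| <= C * t].
have A0 : A 0 by split; rewrite ?lexx ?ler01// subrr normr0 mulr0.
have supA : has_sup A by split; [exists 0|exists 1 => t [/andP[]]].
pose c := sup A.
have c0 : 0 <= c by apply: ub_le_sup => //; case: supA.
have c1 : c <= 1 by apply: ge_sup; [exists 0|move=> t [/andP[]]].
have [d d0 dP] := loc c (introT andP (conj c0 c1)).
have [s [/andP[s0 s1] sA] cs] := sup_adherent d0 supA.
have sc : s <= c by apply: ub_le_sup; [case: supA|split => //; rewrite s0].
have step (t : R) : c <= t <= 1 -> t - c < d -> A t.
  move=> /andP[ct t1] tcd.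
  have t0 : 0 <= t by exact: le_trans ct.
  split; first by rewrite t0.
  have -> : phi t - phi 0 = (phi t - phi c) + ((phi c - phi s) + (phi s - phi 0)).
    by rewrite !addrA !subrK.
  have -> : C * t = C * (t - c) + (C * (c - s) + C * s) by ring.
  rewrite (le_trans (ler_normD _ _))// lerD//.
    have := dP t; rewrite t0 t1 ger0_norm ?subr_ge0//; exact.
  rewrite (le_trans (ler_normD _ _))// lerD// distrC.
  have := dP s; rewrite s0 s1 (distrC s c) ger0_norm ?subr_ge0//; apply => //.
  by rewrite ltrBlDr -ltrBlDl.
have [cl1|] := ltP c 1; last first.
  move=> c1'; have c1E : c = 1 by apply/eqP; rewrite eq_le c1.
  have [] := step 1; rewrite ?c1E ?lexx ?subrr//.
  by rewrite mulr1.
pose t := Num.min 1 (c + d / 2).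
have ct : c < t by rewrite lt_min cl1 ltrDl divr_gt0.
have /(ub_le_sup supA.2) : A t.
  apply: step; first by rewrite (ltW ct) ge_min lexx.
  rewrite ltrBlDl gt_min ltrD2l; apply/orP; right.
  by rewrite ltr_pdivrMr// ltr_pMr// ltr1n.
by rewrite leNgt ct.
Qed.

(** The norm of a normed module need not be detected by the real mean value theorem
in coordinates; the estimate comes from [growth_bound] along the segment. The
slack [e] absorbs the remainder of the differential. *)
Lemma mean_value_inequality E F (f : E -> F) (Df : E -> clinear E F) (B : set E)
    (M : R) (x y : E) :
  (forall t : R, 0 <= t <= 1 -> B (x + t *: (y - x))) ->
  (forall z, B z -> is_diff z f (Df z)) -> (forall z, B z -> `|Df z| <= M) ->
  `|f y - f x| <= M * `|y - x|.
Proof.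
move=> segB df DM; apply/ler_addgt0Pr => e e0.
set v := y - x; pose e1 := e / (`|v| + 1).
have v0 : 0 < `|v| + 1 by rewrite ltr_wpDl.
have e10 : 0 < e1 by rewrite divr_gt0.
pose phi (t : R) := f (x + t *: v).
have -> : f y = phi 1 by rewrite /phi scale1r addrC subrK.
have -> : f x = phi 0 by rewrite /phi scale0r addr0.
rewrite (@le_trans _ _ ((M + e1) * `|v|))//; last first.
  rewrite mulrDl lerD2l /e1 mulrAC ler_pdivrMr// ler_wpM2l ?ltW//.
  by rewrite ltrDl.
apply: growth_bound => c c01.
have := is_diff_lip e10 (df _ (segB c c01)).
move=> /nbhs_ballP[d /= d0 dP]; exists (d / (`|v| + 1)); first by rewrite divr_gt0.
move=> t t01 tc; rewrite /phi.
have := dP ((t - c) *: v).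
rewrite -ball_normE/= sub0r normrN normrZ -/v => /(_ _)/=.
have -> : x + c *: v + (t - c) *: v = x + t *: v.
  by rewrite -addrA -scalerDl (addrC c) subrK.
have tcd : `|t - c| * `|v| < d.
  rewrite (@le_lt_trans _ _ (`|t - c| * (`|v| + 1)))//.
    by rewrite ler_wpM2l// lerDl.
  by rewrite -ltr_pdivlMr.
move=> /(_ tcd)/le_trans; apply.
rewrite mulrA mulrAC ler_wpM2r// ler_wpM2r// lerD2r; exact: DM (segB c c01).
Qed.

End mean_value.

Section lipschitz_perturbation.
Context {R : realType} {Z : completeNormedModType R}.

Definition near_identity (G : Z -> Z) (z0 : Z) (r : R) :=
  forall x y, `|x - z0| <= r -> `|y - z0| <= r ->
  `|G x - G y - (x - y)| <= 2^-1 * `|x - y|.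

(** Two points cannot be brought together by a perturbation that moves their
difference by at most half. *)
Lemma near_identity_expand G z0 r x y : near_identity G z0 r ->
  `|x - z0| <= r -> `|y - z0| <= r -> `|x - y| <= 2 * `|G x - G y|.
Proof.
move=> Gid xr yr; have := Gid x y xr yr.
have : `|x - y| <= `|G x - G y| + `|G x - G y - (x - y)|.
  by rewrite distrC (le_trans _ (ler_normB _ _))// opprB addrCA subrr addr0 distrC.
lra.
Qed.

(** A solution of [G x = y] is a fixed point of [x |-> x - G x + y], a contraction of
the closed ball of radius [r]. *)
Lemma near_identity_surj G z0 r y : 0 <= r -> near_identity G z0 r ->
  `|y - G z0| <= r / 2 -> exists2 x, `|x - z0| <= r & G x = y.
Proof.
move=> r0 Gid yr.
pose U := [set x | `|x - z0| <= r].
pose T x := x - G x + y.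
have TU : set_fun U U T.
  move=> x /= xr; rewrite /U /=.
  have -> : T x - z0 = - (G x - G z0 - (x - z0)) + (y - G z0).
    by rewrite /T !opprB !addrA [RHS](ACl (1*4*5*2*3*6)) /= addrK.
  rewrite (le_trans (ler_normD _ _))// normrN [r]splitr lerD//.
  rewrite (le_trans (Gid _ _ xr _)) ?subrr ?normr0//.
  by rewrite mulrC ler_wpM2r.
have clU : closed U.
  suff <- : closed_ball_ (fun x : Z => `|x|) z0 r = U by exact: closed_closed_ball_.
  by apply/seteqP; split=> x; rewrite /U/= distrC.
pose Tf : {fun U >-> U} := HB.pack T (isFun.Build _ _ U U T TU).
have ctr : is_contraction Tf.
  exists (2^-1)%:nng; split => /=; first by rewrite invf_lt1 ?ltr1n.
  move=> [a b] [/= aU bU]; rewrite /T.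
  rewrite (le_trans _ (Gid _ _ aU bU))// -normrN le_eqVlt; apply/orP; left.
  apply/eqP; congr (`| _ |).
  have -> : a - G a + y - (b - G b + y) = (a - G a) - (b - G b).
    by rewrite opprD addrACA subrr addr0.
  by rewrite !opprB !addrA [LHS](ACl (3*2*1*4)).
have [] := banach_fixed_point ctr.
- exact: clU.
- by exists z0; rewrite /U/= subrr normr0.
- move=> p pU pT; exists p => //.
  have : p = p - G p + y by exact: pT.
  move=> /(congr1 (fun q => q - (p - G p))) /=.
  by rewrite [in RHS]addrAC subrr add0r opprB addrC subrK.
Qed.

End lipschitz_perturbation.

(** * The inverse function theorem *)

Section inverse_function.
Context {R : realType}.

(** The derivative of the inverse is [S \o g]: differentiability of [g] comes from its
Lipschitz bound, and higher smoothness by induction, [g] being as smooth as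
[S \o g] was at the previous order. *)
Lemma Ck_inverse_map k (E F : normedModType R) (U : set E) (W : set F)
    (f : E -> F) (g : F -> E) (Df : E -> clinear E F) (S : E -> clinear F E)
    (M N : R) :
  open U -> open W -> (forall y, W y -> U (g y)) -> (forall y, W y -> f (g y) = y) ->
  (forall y y', W y -> W y' -> `|g y - g y'| <= N * `|y - y'|) ->
  (forall x, U x -> is_diff x f (Df x)) ->
  (forall x y, U x -> S x (Df x y) = y) -> (forall x y, U x -> Df x (S x y) = y) ->
  (forall x, U x -> `|S x| <= M) -> Ck k U f -> Ck k W g.
Proof.
move=> oU oW gU fg gN df SD DS SM.
have gcts y : W y -> {for y, continuous g}.
  move=> Wy; apply/cvgrPdist_le => e e0.
  have N0 : 0 < `|N| + 1 by rewrite ltr_wpDl.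
  have eN : 0 < e / (`|N| + 1) by rewrite divr_gt0.
  have : \forall y' \near y, `|y - y'| <= e / (`|N| + 1).
    by apply: (@cvgr_dist_le _ _ _ _ _ id y).
  apply: filter_app; apply: filterS (open_nbhs_nbhs (conj oW Wy)) => y' Wy' yy'.
  rewrite (le_trans (gN _ _ Wy Wy'))// (@le_trans _ _ ((`|N| + 1) * (e / (`|N| + 1))))//.
    rewrite (@le_trans _ _ ((`|N| + 1) * `|y - y'|))//.
      by rewrite ler_wpM2r// (le_trans (ler_norm _))// lerDl.
    by rewrite ler_wpM2l// ltW.
  by rewrite mulrC divfK ?gt_eqF.
elim: k => [|k IH] Cf; first by [].
have CDf : Ck k U Df.
  have [Df' [dDf' CDf']] := Cf.
  by apply: (Ck_congr oU _ CDf') => x Ux; apply: is_diff_uniq (dDf' x Ux) (df x Ux).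
exists (S \o g); split; last first.
  apply: (Ck_comp gU); first exact: IH (Ck_pred Cf).
  exact: (Ck_inverse_operator oU SD DS SM CDf).
move=> y Wy; apply/is_diffP => e e0.
have Ugy := gU _ Wy.
have M0 : 0 <= M by rewrite (le_trans _ (SM _ Ugy)).
have M10 : 0 < M + 1 by rewrite ltr_wpDl.
have N0 : 0 < `|N| + 1 by rewrite ltr_wpDl.
pose e1 := e / ((M + 1) * (`|N| + 1)).
have e10 : 0 < e1 by rewrite divr_gt0// mulr_gt0.
have hW : \forall h \near (0 : F), W (y + h).
  have : (fun h : F => y + h) @ (0 : F) --> y.
    by rewrite -[X in _ --> X]addr0; apply: cvgD; [exact: cvg_cst|exact: cvg_id].
  by apply; exact: open_nbhs_nbhs.
have hg : \forall h \near (0 : F),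
    `|f (g (y + h)) - f (g y) - Df (g y) (g (y + h) - g y)| <=
    e1 * `|g (y + h) - g y|.
  have c0 : (fun h : F => g (y + h) - g y) @ (0 : F) --> (0 : E).
    rewrite -(subrr (g y)); apply: cvgB; last exact: cvg_cst.
    have yh : (fun h : F => y + h) @ (0 : F) --> y.
      by rewrite -[X in _ --> X]addr0; apply: cvgD; [exact: cvg_cst|exact: cvg_id].
    exact: (cvg_comp _ _ yh (gcts _ Wy)).
  have /is_diffP/(_ _ e10) := df _ Ugy.
  move=> /c0; rewrite /= nbhs_simpl/=; apply: filterS => h.
  by rewrite /= [g y + _]addrC subrK.
apply: filter_app hg; apply: filterS hW => h Wyh hg.
rewrite !fg// [y + h]addrC addrK in hg *.
have -> : g (h + y) - g y - (S \o g) y h =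
    - S (g y) (h - Df (g y) (g (h + y) - g y)).
  by rewrite linearB/= SD// opprB.
rewrite normrN (le_trans (clinear_le _ _))//.
rewrite (@le_trans _ _ ((M + 1) * (e1 * ((`|N| + 1) * `|h|))))//.
  rewrite ler_pM//; first by rewrite (le_trans (SM _ Ugy))// lerDl.
  rewrite (le_trans hg)// ler_wpM2l// ?(ltW e10)//.
  rewrite (le_trans (gN _ _ _ Wy))//; first by rewrite addrC.
  by rewrite addrK ler_wpM2r// (le_trans (ler_norm _))// lerDl.
have -> : (M + 1) * (e1 * ((`|N| + 1) * `|h|)) = e * `|h|.
  by rewrite /e1; field; rewrite !gt_eqF.
by [].
Qed.

Context {Z : completeNormedModType R}.

Lemma near_identity_subset (G : Z -> Z) z0 r z1 s : `|z1 - z0| + s <= r ->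
  near_identity G z0 r -> near_identity G z1 s.
Proof.
move=> zs Gid x y xs ys.
have sub t : `|t - z1| <= s -> `|t - z0| <= r.
  move=> ts; rewrite -(subrK z1 t) -addrA (le_trans (ler_normD _ _))//.
  by rewrite (le_trans _ zs)// [leRHS]addrC lerD2r.
by apply: Gid; exact: sub.
Qed.

(** [near_identity_surj] applies to every small ball around every point. *)
Lemma near_identity_open (G : Z -> Z) z0 r (O : set Z) : near_identity G z0 r ->
  open O -> (forall x, O x -> `|x - z0| < r) -> open (G @` O).
Proof.
move=> Gid oO Or; rewrite openE => _ [x Ox <-].
have := open_nbhs_nbhs (conj oO Ox) => /nbhs_ballP[d /= d0 dO].
(* the ball of radius [s] around [x] is inside both [O] and the given ball *)
pose s := Num.min (d / 2) (r - `|x - z0|).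
have s0 : 0 < s by rewrite lt_min divr_gt0// subr_gt0 Or.
have Gidx : near_identity G x s.
  by apply: near_identity_subset Gid; rewrite -lerBrDl ge_min lexx orbT.
rewrite /interior; apply/nbhs_ballP; exists (s / 2); rewrite /= ?divr_gt0// => y.
rewrite -ball_normE/= distrC => /ltW ys.
have [x' xx' <-] := near_identity_surj (ltW s0) Gidx ys.
exists x' => //; apply: dO; rewrite -ball_normE/= distrC (le_lt_trans xx')//.
by rewrite gt_min ltr_pdivrMr// ltr_pMr// ltr1n.
Qed.

(** Such an operator is a map close to the identity on balls of every radius, so
[near_identity_surj] and [near_identity_expand] give its inverse. *)
Lemma near_identity_operator (T : clinear Z Z) : `|T - clinear_id Z| <= 2^-1 ->
  exists S : clinear Z Z,
    [/\ forall x, S (T x) = x, forall x, T (S x) = x & `|S| <= 2].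
Proof.
move=> T2.
have Tid r : near_identity T 0 r.
  move=> x y _ _; rewrite -linearB.
  rewrite [X in `|X|](_ : _ = (T - clinear_id Z) (x - y))//.
  by rewrite (le_trans (clinear_le _ _))// ler_wpM2r.
have Texp x : `|x| <= 2 * `|T x|.
  have := @near_identity_expand _ _ T 0 `|x| x 0 (Tid _).
  by rewrite !subr0 normr0 linear0 subr0; exact.
have Tinj x y : T x = T y -> x = y.
  move=> Txy; apply/eqP; rewrite -subr_eq0 -normr_eq0 eq_le normr_ge0 andbT.
  by rewrite (le_trans (Texp _))// linearB/= Txy subrr normr0 mulr0.
have Tsurj y : exists x, T x = y.
  have [||x _ Tx] := @near_identity_surj _ _ T 0 (2 * `|y|) y _ (Tid _).
  - by rewrite mulr_ge0.
  - by rewrite linear0 subr0 mulrAC mulfV ?mul1r.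
  - by exists x.
have [S TS] := choice Tsurj.
have Slin : linear S by move=> a x y; apply: Tinj; rewrite TS linearP/= !TS.
have Sbnd x : `|S x| <= 2 * `|x| by rewrite (le_trans (Texp _))// TS.
exists (mkclinear Slin Sbnd); split => [x|x|].
- by apply: Tinj; rewrite TS.
- exact: TS.
- exact: opnorm_le_bound.
Qed.

(** Banach space inverse function theorem, for an identity differential. Near [z0]
the mean value inequality makes [F] close to the identity, and its
differentials are invertible with inverses bounded by 2. *)
Theorem inverse_function (F : Z -> Z) (U : set Z) (z0 : Z) :
  open U -> U z0 -> Cinfty U F -> is_diff z0 F (clinear_id Z) ->
  exists2 r : R, 0 < r & [/\ forall z, `|z - z0| <= r -> U z,
    near_identity F z0 r &
    forall (O : set Z) (G : Z -> Z), open O -> (forall x, O x -> `|x - z0| < r) ->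
      (forall x, O x -> G (F x) = x) -> Cinfty (F @` O) G].
Proof.
move=> oU Uz0 CF dF; have [DF [dDF CDF]] := CF 1%N.
have DF0 : DF z0 = clinear_id Z := is_diff_uniq (dDF _ Uz0) dF.
have : \forall z \near z0, U z /\ `|DF z - clinear_id Z| <= 2^-1.
  apply: filterI; first exact: open_nbhs_nbhs.
  have /cvgrPdist_le/(_ 2^-1) := CDF _ Uz0; rewrite DF0 invr_gt0 ltr0n => /(_ isT).
  by apply: filterS => z; rewrite distrC.
move=> /nbhs_ballP[d /= d0 dP].
have d20 : 0 < d / 2 by rewrite divr_gt0.
have rP z : `|z - z0| <= d / 2 -> U z /\ `|DF z - clinear_id Z| <= 2^-1.
  move=> zd; apply: dP; rewrite -ball_normE/= distrC (le_lt_trans zd)//.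
  by rewrite ltr_pdivrMr// ltr_pMr// ltr1n.
have Fid : near_identity F z0 (d / 2).
  move=> x y xd yd.
  have -> : F x - F y - (x - y) = (F x - clinear_id Z x) - (F y - clinear_id Z y).
    by rewrite !opprB !addrA [LHS](ACl (1*4*3*2)).
  apply: (@mean_value_inequality _ _ _ (fun z => F z - clinear_id Z z)
    (fun z => DF z - clinear_id Z) [set z | `|z - z0| <= d / 2]).
  - move=> t /andP[t0 t1] /=.
    have -> : y + t *: (x - y) - z0 = (1 - t) *: (y - z0) + t *: (x - z0).
      have -> : x - y = (x - z0) - (y - z0) by rewrite opprB addrA subrK.
      by rewrite scalerBl scale1r -[RHS]addrA [X in _ = _ + X]addrC -scalerBr addrAC.
    rewrite (le_trans (ler_normD _ _))// !normrZ ger0_norm ?subr_ge0// ger0_norm//.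
    have -> : d / 2 = (1 - t) * (d / 2) + t * (d / 2) by ring.
    by rewrite lerD// ler_wpM2l// subr_ge0.
  - move=> z /rP[Uz _].
    have dN : is_diff z (fun y => - clinear_id Z y) (- clinear_id Z).
      exact: (@is_diff_clinear _ _ _ (- clinear_id Z) z).
    exact: (is_diff_add (dDF z Uz) dN).
  - by move=> z /rP[].
exists (d / 2) => //; split => [z /rP[]//|//|O G oO Or GF k].
have Sex z : exists S : clinear Z Z, `|z - z0| < d / 2 ->
    [/\ forall x, S (DF z x) = x, forall x, DF z (S x) = x & `|S| <= 2].
  have [zd|zd] := ltP `|z - z0| (d / 2); last by exists 0.
  by have [S SP] := near_identity_operator (rP _ (ltW zd)).2; exists S.
have [S SP] := choice Sex.
have OU : O `<=` U by move=> x /Or/ltW/rP[].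
apply: (@Ck_inverse_map k _ _ O _ F G DF S 2 2) => //.
- exact: near_identity_open Or.
- by move=> _ [x Ox <-]; rewrite GF.
- by move=> _ [x Ox <-]; rewrite GF.
- move=> _ _ [x Ox <-] [x' Ox' <-]; rewrite !GF//.
  by apply: near_identity_expand Fid _ _; exact/ltW/Or.
- by move=> x /OU; exact: dDF.
- by move=> x y /Or/SP[].
- by move=> x y /Or/SP[].
- by move=> x /Or/SP[].
- exact: Ck_subset (CF k).
Qed.

End inverse_function.

(** * Compactness, and smoothness into a closed submodule *)

Section compactness.
Context {R : realType}.
Implicit Types V W : normedModType R.

Lemma compact_bound (T : topologicalType) W (K : set T) (f : T -> W) : compact K ->
  {within K, continuous f} -> exists M : R, forall v, K v -> `|f v| <= M.
Proof.
move=> cK cf; have /compact_bounded[M [_ fM]] := continuous_compact cf cK.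
exists (M + 1) => v Kv; apply: fM; first by rewrite ltrDl.
by exists v.
Qed.

(** Stronger than uniform continuity on [K]: the second point ranges over a
neighborhood of [K], which contains all functions close to one with values in
[K]. *)
Lemma compact_unif_cts V W (K : set V) (f : V -> W) : compact K ->
  (forall v, K v -> {for v, continuous f}) ->
  forall e : R, 0 < e -> exists2 d : R, 0 < d &
  forall v v', K v -> `|v' - v| < d -> `|f v' - f v| <= e.
Proof.
move=> cK cf e e0.
have e20 : 0 < e / 2 by rewrite divr_gt0.
have H := (compact_near_coveringP K).1 cK R (0 : R)^'+
  (fun d v => forall v', `|v' - v| < d -> `|f v' - f v| <= e) _.
have {H}/H : forall v, K v -> \forall v1 \near v & d \near (0 : R)^'+,
    forall v', `|v' - v1| < d -> `|f v' - f v1| <= e.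
  move=> v Kv; have /cvgrPdist_le/(_ _ e20)/nbhs_ballP[r /= r0 rP] := cf v Kv.
  have r20 : 0 < r / 2 by rewrite divr_gt0.
  exists (ball v (r / 2), [set d | d < r / 2]).
    by split; [exact: nbhsx_ballx|exact: nbhs_right_lt].
  move=> [v1 d] [/= vv1 dr] v' v'd; rewrite -ball_normE/= in vv1.
  have vr w : `|v - w| < r -> `|f v - f w| <= e / 2.
    by move=> vw; apply: rP; rewrite -ball_normE.
  rewrite -(subrK (f v) (f v')) -addrA (le_trans (ler_normD _ _))// [e]splitr lerD//.
    rewrite distrC vr// -(subrK v1 v) -addrA (le_lt_trans (ler_normD _ _))//.
    by rewrite [r]splitr ltrD// distrC (lt_trans v'd).
  by rewrite vr// (lt_trans vv1)// ltr_pdivrMr// ltr_pMr// ltr1n.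
move=> Hd; have [d [d0 dP]] := filter_ex (filterI (nbhs_right_gt (0 : R)) Hd).
by exists d => // v v' Kv; exact: dP.
Qed.

Lemma compact_tube V (K U : set V) : compact K -> open U -> K `<=` U ->
  exists2 d : R, 0 < d & forall v v', K v -> `|v' - v| < d -> U v'.
Proof.
move=> cK oU KU.
have H := (compact_near_coveringP K).1 cK R (0 : R)^'+
  (fun d v => forall v', `|v' - v| < d -> U v') _.
have {H}/H : forall v, K v -> \forall v1 \near v & d \near (0 : R)^'+,
    forall v', `|v' - v1| < d -> U v'.
  move=> v /KU Uv; have := open_nbhs_nbhs (conj oU Uv).
  move=> /nbhs_ballP[r /= r0 rP].
  have r20 : 0 < r / 2 by rewrite divr_gt0.
  exists (ball v (r / 2), [set d | d < r / 2]).
    by split; [exact: nbhsx_ballx|exact: nbhs_right_lt].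
  move=> [v1 d] [/= vv1 dr] v' v'd; rewrite -ball_normE/= in vv1.
  apply: rP; rewrite -ball_normE/= -(subrK v1 v) -addrA.
  rewrite (le_lt_trans (ler_normD _ _))//.
  by rewrite [r]splitr ltrD// distrC (lt_trans v'd).
move=> Hd; have [d [d0 dP]] := filter_ex (filterI (nbhs_right_gt (0 : R)) Hd).
by exists d => // v v' Kv; exact: dP.
Qed.

Lemma closed_approx V (C : set V) (v : V) : closed C ->
  (forall e : R, 0 < e -> exists2 c, C c & `|v - c| <= e) -> C v.
Proof.
move=> clC app; apply: clC => B /nbhs_ballP[d /= d0 dB].
have d20 : 0 < d / 2 by rewrite divr_gt0.
have [c Cc vc] := app _ d20; exists c; split => //; apply: dB.
by rewrite -ball_normE/= (le_lt_trans vc)// ltr_pdivrMr// ltr_pMr// ltr1n.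
Qed.
End compactness.

Section descent.
Context {R : realType}.

(** The differential of [iota \o f] is a limit of difference quotients lying in the
closed range of [iota], so it factors through [iota]; and composing with [iota]
is again an isometry with closed range, between spaces of operators, which lets
the induction on [k] proceed. *)
Lemma Ck_descend k (E F B : normedModType R) (iota : clinear F B) (U : set E)
    (f : E -> F) : open U ->
  (forall x, `|iota x| = `|x|) -> closed (range iota) ->
  Ck k U (iota \o f) -> Ck k U f.
Proof.
move=> oU; elim: k F B iota f => [|k IH] F B iota f iso clo.
  move=> cf x Ux; apply/cvgrPdist_le => e e0.
  have /cvgrPdist_le/(_ e e0) := cf x Ux; apply: filterS => y /=.
  by rewrite -linearB iso.
move=> [Df [dDf CDf]].
have inj x y : iota x = iota y -> x = y.
  move=> xy; apply/eqP; rewrite -subr_eq0 -normr_eq0 -iso linearB/= xy subrr.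
  by rewrite normr0.
have Drange x h : U x -> exists v, iota v = Df x h.
  move=> Ux; suff [v _ vE] : range iota (Df x h) by exists v.
  apply: closed_approx => // e e0.
  have h0 : 0 < `|h| + 1 by rewrite ltr_wpDl.
  have eh : 0 < e / (`|h| + 1) by rewrite divr_gt0.
  have /is_diffP/(_ _ eh) /nbhs_ballP[d /= d0 dP] := dDf x Ux.
  pose t := d / 2 / (`|h| + 1); have t0 : 0 < t by rewrite !divr_gt0.
  have thd : ball (0 : E) d (t *: h).
    rewrite -ball_normE/= sub0r normrN normrZ gtr0_norm//.
    rewrite (@le_lt_trans _ _ (t * (`|h| + 1)))//; first by rewrite ler_wpM2l ?ltW// ltrDl.
    by rewrite divfK ?gt_eqF// ltr_pdivrMr// ltr_pMr// ltr1n.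
  exists (iota (t^-1 *: (f (x + t *: h) - f x))); first by exists (t^-1 *: (f (x + t *: h) - f x)).
  rewrite linearZ/=.
  have -> : Df x h = t^-1 *: Df x (t *: h).
    by rewrite linearZ/= scalerA mulVf ?scale1r// gt_eqF.
  rewrite -scalerBr normrZ gtr0_norm ?invr_gt0// ler_pdivrMl//.
  rewrite distrC linearB/= (le_trans (dP _ thd))//.
  rewrite normrZ gtr0_norm// mulrCA ler_wpM2l ?(ltW t0)//.
  by rewrite mulrAC ler_pdivrMr// ler_wpM2l ?(ltW e0)// lerDl.
have Tex x : exists T : clinear E F, U x -> forall h, iota (T h) = Df x h.
  have [Ux|nUx] := pselect (U x); last by exists 0.
  have [g gE] := choice (fun h => Drange x h Ux).
  have lg : linear g by move=> a u v; apply: inj; rewrite gE !linearP/= !gE.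
  have bg h : `|g h| <= `|Df x| * `|h| by rewrite -iso gE clinear_le.
  by exists (mkclinear lg bg).
have [T TE] := choice Tex.
exists T; split.
  move=> x Ux; apply/is_diffP => e e0; have /is_diffP/(_ _ e0) := dDf x Ux.
  by apply: filterS => h /=; rewrite -TE// -!linearB/= iso.
apply: (IH _ _ (compose E F B iota)).
- move=> S; apply/eqP; rewrite eq_le; apply/andP; split.
    apply: opnorm_le_bound => // h; rewrite composeE iso; exact: clinear_le.
  apply: opnorm_le_bound => // h; rewrite -iso -composeE; exact: clinear_le.
- move=> S clS.
  have Srange h : exists v, iota v = S h.
    suff [v _ vE] : range iota (S h) by exists v.
    apply: clo => N /nbhs_ballP[d /= d0 dN].
    have h0 : 0 < `|h| + 1 by rewrite ltr_wpDl.
    have [_ [[T' _ <-] ST']] := clS _ (nbhsx_ballx S _ (divr_gt0 d0 h0)).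
    exists (iota (T' h)); split; first by exists (T' h).
    apply: dN; rewrite -!ball_normE/= in ST' *.
    rewrite (le_lt_trans (clinear_le (S - compose E F B iota T') h))//.
    rewrite (@le_lt_trans _ _ (`|S - compose E F B iota T'| * (`|h| + 1)))//.
      by rewrite ler_wpM2l// lerDl.
    by rewrite -ltr_pdivlMr.
  have [g gE] := choice Srange.
  have lg : linear g by move=> a u v; apply: inj; rewrite gE !linearP/= !gE.
  have bg h : `|g h| <= `|S| * `|h| by rewrite -iso gE clinear_le.
  by exists (mkclinear lg bg) => //; apply: clinearP => h; rewrite composeE/= gE.
- by apply: (Ck_congr oU _ CDf) => x Ux; apply: clinearP => h; rewrite /= TE.
Qed.
End descent.

(** * Composition operators on bounded functions *)

Section nemytskii.
Context {R : realType}.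

Section multiplication.
Context {X Y : Type} {V W : normedModType R} (h : Y -> X).

Let mult_bound (L : bfun Y (clinear V W)) (u : bfun X V) y :
  `|L y (u (h y))| <= `|L| * `|u|.
Proof. by rewrite (le_trans (clinear_le _ _))// ler_pM// bfun_le. Qed.

Let mult (L : bfun Y (clinear V W)) (u : bfun X V) : bfun Y W :=
  mkbfun (fun y => L y (u (h y))).

Let multE L u y : mult L u y = L y (u (h y)).
Proof. by rewrite /mult (mkbfunE (mult_bound L u)). Qed.

Definition bfun_mult :
  clinear (bfun Y (clinear V W)) (clinear (bfun X V) (bfun Y W)).
Proof.
apply: (@mkbilinear _ _ _ _ mult 1).
- by move=> u a L L'; apply: bfunP => y; rewrite bfunDE bfunZE !multE.
- move=> L a u u'; apply: bfunP => y.
  by rewrite bfunDE bfunZE !multE -linearP.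
- move=> L u; rewrite mul1r; apply/bfun_normP; first by rewrite mulr_ge0.
  by move=> y; rewrite multE; exact: mult_bound.
Defined.

Lemma bfun_multE L u y : bfun_mult L u y = L y (u (h y)).
Proof. exact: multE. Qed.
End multiplication.

Context {X Y : Type} {V : normedModType R} (h : Y -> X) (P : Y -> Prop).

(** Composition with [tau], truncated to zero outside [P]: the transition maps are
defined only at the places [y] where two pieces overlap. *)
Definition nemytskii (W : normedModType R) (tau : V -> W) (w : bfun X V) :
    bfun Y W :=
  mkbfun (fun y => if pselect (P y) then tau (w (h y)) else 0).

Variables (K U : set V) (w0 : bfun X V) (d : R).
Hypotheses (cK : compact K) (KU : K `<=` U).
Hypothesis w0K : forall y v, P y -> `|v - w0 (h y)| < d -> K v.

Let ballK (w : bfun X V) y : ball w0 d w -> P y -> K (w (h y)).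
Proof.
rewrite -ball_normE/= => wd Py; apply: w0K Py _.
by rewrite (le_lt_trans _ wd)// distrC (bfun_le (w0 - w)).
Qed.

Let tau_bound (W : normedModType R) (tau : V -> W) :
  (forall v, K v -> {for v, continuous tau}) ->
  exists2 M : R, 0 <= M & forall v, K v -> `|tau v| <= M.
Proof.
move=> ct; have [M MP] : exists M : R, forall v, K v -> `|tau v| <= M.
  apply: compact_bound => //.
  by apply: continuous_in_subspaceT => v /set_mem; exact: ct.
by exists `|M| => // v Kv; rewrite (le_trans (MP v Kv))// ler_norm.
Qed.

Lemma nemytskiiE k (W : normedModType R) (tau : V -> W) w y : Ck k U tau ->
  ball w0 d w ->
  nemytskii tau w y = if pselect (P y) then tau (w (h y)) else 0.
Proof.
move=> Ct wd; have [|M M0 MP] := @tau_bound W tau.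
  by move=> v /KU; exact: (Ck_continuous Ct).
rewrite /nemytskii (@mkbfunE _ _ _ _ M)// => z.
by case: (pselect (P z)) => [Pz|nPz] /=; [exact/MP/ballK|rewrite normr0].
Qed.

(** The derivative at [w] is multiplication by the values of another composition
operator, for the derivative of [tau]; this gives the induction on [k]. The
remainder is small uniformly in [y] by the mean value inequality, since the
derivative of [tau] is uniformly continuous near the compact set [K]. *)
Lemma nemytskii_Ck k (W : normedModType R) (tau : V -> W) :
  Ck k U tau -> Ck k (ball w0 d) (nemytskii tau).
Proof.
elim: k W tau => [|k IH] W tau Ct.
  move=> w wd; apply/(@cvgrPdist_le _ _ _ _ (nbhs_filter w)) => e e0.
  have [|r r0 rP] := @compact_unif_cts _ _ _ K tau cK _ e e0.
    by move=> v /KU; exact: Ct.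
  have nd : nbhs w (ball w0 d) by apply: open_nbhs_nbhs; split => //; exact: ball_open.
  apply: filterS (filterI nd (nbhsx_ballx w _ r0)) => w' [w'd]; rewrite -ball_normE/= => ww'.
  apply/bfun_normP; first exact: ltW.
  move=> y; rewrite bfunBE !(nemytskiiE _ Ct)//.
  case: (pselect (P y)) => [Py|nPy] /=; last by rewrite subrr normr0 ltW.
  rewrite distrC; apply: rP; first exact: ballK.
  by rewrite distrC (le_lt_trans _ ww')// (bfun_le (w - w')).
have [Dt [dDt CDt]] := Ct.
exists (fun w => bfun_mult h (nemytskii Dt w)); split; last first.
  by apply: (Ck_postcomp (bfun_mult h)); exact: IH.
move=> w wd; apply/is_diffP => e e0.
have [|r r0 rP] := @compact_unif_cts _ _ _ K Dt cK _ e e0.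
  by move=> v /KU; exact: (Ck_continuous CDt).
have wdK : ball w0 d w by [].
rewrite -ball_normE/= in wdK.
pose s := Num.min r (d - `|w0 - w|).
have s0 : 0 < s by rewrite lt_min r0 subr_gt0.
have sball u : `|u| < s -> ball w0 d (w + u).
  rewrite lt_min => /andP[_ us]; rewrite -ball_normE/= opprD addrA.
  by rewrite (le_lt_trans (ler_normB _ _))// -ltrBrDl.
have : \forall u \near (0 : bfun X V), ball 0 s u by exact: nbhsx_ballx.
apply: filterS => u; rewrite -ball_normE/= sub0r normrN => us.
apply/bfun_normP; first by rewrite mulr_ge0// ltW.
move=> y; rewrite !bfunBE bfun_multE !(nemytskiiE _ Ct)//; last exact: sball.
rewrite (nemytskiiE _ CDt)//; case: (pselect (P y)) => [Py|nPy] /=; last first.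
  by rewrite subrr sub0r normrN [X in `|X| <= _](_ : _ = 0)// normr0 mulr_ge0// ltW.
pose a := w (h y); pose b := u (h y).
suff : `|tau (a + b) - tau a - Dt a b| <= e * `|u| by [].
have bu : `|b| <= `|u| by exact: bfun_le.
rewrite (@le_trans _ _ (e * `|b|))//; last by rewrite ler_wpM2l// ltW.
have := @mean_value_inequality _ _ _ (fun z => tau z - Dt a z)
  (fun z => Dt z - Dt a) [set z | K z /\ `|z - a| < r] e a (a + b).
have -> : tau (a + b) - Dt a (a + b) - (tau a - Dt a a) = tau (a + b) - tau a - Dt a b.
  by rewrite linearD/= !opprD !addrA opprK [LHS](ACl (1*4*3*5*2)) /= addrK.
rewrite addrAC subrr add0r; apply.
- move=> t /andP[t0 t1] /=;
  have tb : `|t *: b| < s.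
    by rewrite normrZ ger0_norm// (le_lt_trans _ us)// (le_trans _ bu)// ler_piMl.
  split; last by rewrite addrAC subrr add0r (lt_le_trans tb)// ge_min lexx.
  have tus : `|t *: u| < s.
    by rewrite normrZ ger0_norm// (le_lt_trans _ us)// ler_piMl.
  have := ballK (sball _ tus) Py; by rewrite bfunDE bfunZE.
- move=> z [Kz _].
  have dN : is_diff z (fun y => - Dt a y) (- Dt a) := is_diff_clinear (- Dt a) z.
  exact: (is_diff_add (dDt z (KU Kz)) dN).
- by move=> z [Kz za]; apply: rP => //; exact: ballK.
Qed.
End nemytskii.

(** * The compact-open topology on a mapping space *)

Section mapping_space_topology.
Context {A M : topologicalType}.
Implicit Types f g : mapping_space A M.

Definition evalmap (f : mapping_space A M) : A -> M := (f : continuousType A M).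

Lemma evalmap_cts f : continuous (evalmap f).
Proof. exact: (@cts_fun A M f). Qed.

Lemma evalmapP f g : evalmap f =1 evalmap g -> f = g.
Proof. by move=> fg; apply/continuousEP. Qed.

Section with_compact_open.
Import ArrowAsCompactOpen.

Lemma mapping_space_cvgP (F : set_system (mapping_space A M)) f : Filter F ->
  (F --> f) <-> forall K O, compact K -> open O -> evalmap f @` K `<=` O ->
    F [set g | evalmap g @` K `<=` O].
Proof.
move=> FF; split.
  move=> Ff K O cK oO fKO; apply: Ff; apply: open_nbhs_nbhs; split=> //.
  exists [set g : {compact-open, A -> M} | g @` K `<=` O] => //.
  exact: compact_open_open.
move=> H U; rewrite nbhsE => -[B [[N oN <-] Nf] BU].
have : (evalmap @ F : set_system {compact-open, A -> M}) --> (evalmap f : {compact-open, A -> M}).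
  by apply/compact_open_cvgP => K O' cK oO' fO'; exact: H.
move=> /(_ N (open_nbhs_nbhs (conj oN Nf))) FN.
have {}FN : F (evalmap @^-1` N) := FN.
by apply: filterS FN => g Ng; exact: BU.
Qed.
Lemma mapping_space_open (K : set A) (O : set M) : compact K -> open O ->
  open [set g : mapping_space A M | evalmap g @` K `<=` O].
Proof.
move=> cK oO; exists [set g : {compact-open, A -> M} | g @` K `<=` O] => //.
exact: compact_open_open.
Qed.
End with_compact_open.

Lemma mapping_space_hausdorff :
  hausdorff_space M -> hausdorff_space (mapping_space A M).
Proof.
rewrite !open_hausdorff => hM f g fg.
have [a fga] : exists a, evalmap f a != evalmap g a.
  apply: contrapT => /forallNP fga; move/eqP : fg; apply; apply: evalmapP => a.
  by apply/eqP; have /negP := fga a; rewrite negbK.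
have [[U N] [/= fU gN] [oU oN UN0]] := hM _ _ fga.
have ca : compact [set a] by exact: compact_set1.
exists ([set h | evalmap h @` [set a] `<=` U], [set h | evalmap h @` [set a] `<=` N]).
  by split; apply/mem_set => _ [_ -> <-]; exact/set_mem.
split; [exact: mapping_space_open|exact: mapping_space_open|].
apply/eqP; rewrite -subset0 => h [hU hN].
have : (U `&` N) (evalmap h a) by split; [apply: hU|apply: hN]; exists a.
by rewrite (eqP UN0).
Qed.
End mapping_space_topology.

(** * Charts and maps from a compact space *)

Section charts.
Context {R : realType} {T : topologicalType} {E : normedModType R}.
Variable phi : chart T E.

Lemma chart_preimage_open (B : set E) : open B ->
  open (chart_dom phi `&` phi @^-1` B).
Proof.
move=> oB; rewrite openE => x [dx Bx].
apply: filterI; first exact: open_nbhs_nbhs (conj (chart_dom_open phi) dx).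
by apply: (chart_fun_cts dx); exact: open_nbhs_nbhs.
Qed.

Lemma chart_image_open (N : set T) : open N -> open (phi @` (chart_dom phi `&` N)).
Proof.
move=> oN; rewrite openE => _ [x [dx Nx] <-].
have img : (phi @` chart_dom phi) (phi x) by exists x.
have n1 : nbhs (phi x) (phi @` chart_dom phi).
  exact: open_nbhs_nbhs (conj (chart_img_open phi) img).
have n2 : nbhs (phi x) (chart_inv phi @^-1` N).
  apply: (chart_inv_cts img); rewrite chart_funK//.
  exact: open_nbhs_nbhs.
apply: filterS (filterI n1 n2) => _ [[y dy <-]]; rewrite /= chart_funK// => Ny.
by exists y.
Qed.

End charts.

Section compact_source.
Context {R : realType} {A M : topologicalType} {E : normedModType R}.
Hypothesis cA : compact [set: A].
Variable phi : chart M E.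

Lemma closed_compact (Q : set A) : closed Q -> compact Q.
Proof. by move=> cQ; exact: (subclosed_compact cQ cA). Qed.

Lemma chart_comp_cts (f : A -> M) a : continuous f -> chart_dom phi (f a) ->
  {for a, continuous (phi \o f)}.
Proof. by move=> cf da; apply: continuous_comp; [exact: cf|exact: chart_fun_cts]. Qed.

Lemma chart_image_compact (f : A -> M) (Q : set A) : continuous f -> compact Q ->
  (forall a, Q a -> chart_dom phi (f a)) -> compact ((phi \o f) @` Q).
Proof.
move=> cf cQ Qd; apply: continuous_compact cQ.
apply: continuous_in_subspaceT => a /set_mem Qa.
by apply: chart_comp_cts => //; exact: Qd.
Qed.

(** Each point [a] of [Q] has a neighborhood whose closure in [Q] is a compact set that
[f] maps into a small ball of the chart. Maps near [f] do the same, and finitely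
many such neighborhoods cover [Q]. *)
Lemma chart_near_unif (f : mapping_space A M) (Q : set A) (e : R) : closed Q ->
  (forall a, Q a -> chart_dom phi (evalmap f a)) -> 0 < e ->
  \forall g \near f, forall a, Q a ->
    chart_dom phi (evalmap g a) /\ `|phi (evalmap g a) - phi (evalmap f a)| <= e.
Proof.
move=> clQ Qd e0; have cQ := closed_compact clQ.
have := (near_covering_withinP Q).2 ((compact_near_coveringP Q).1 cQ)
  (mapping_space A M) (nbhs f)
  (fun g a => chart_dom phi (evalmap g a) /\ `|phi (evalmap g a) - phi (evalmap f a)| <= e)
  _; apply.
move=> a Qa.
have e40 : 0 < e / 4 by rewrite divr_gt0.
have e20 : 0 < e / 2 by rewrite divr_gt0.
pose B := [set b | `|phi (evalmap f a) - phi (evalmap f b)| < e / 4].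
have nB : nbhs a B.
  have := chart_comp_cts (@evalmap_cts _ _ f) (Qd _ Qa).
  by move=> /cvgrPdist_lt/(_ _ e40).
pose K := Q `&` closure B.
have cK : compact K by apply: compact_closedI => //; exact: closed_closure.
pose N := chart_dom phi `&` phi @^-1` ball (phi (evalmap f a)) (e / 2).
have oN : open N by apply: chart_preimage_open; exact: ball_open.
have fKN : evalmap f @` K `<=` N.
  move=> _ [b [Qb clb] <-]; split; first exact: Qd.
  have := chart_comp_cts (@evalmap_cts _ _ f) (Qd _ Qb).
  move=> /cvgrPdist_lt/(_ _ e40) /clb[b' [Bb' /= bb']].
  rewrite -ball_normE/= -(subrK (phi (evalmap f b')) (phi (evalmap f a))) -addrA.
  rewrite (le_lt_trans (ler_normD _ _))//.
  by rewrite (_ : e / 2 = e / 4 + e / 4); [rewrite ltrD// distrC|field].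
have nK : nbhs f [set g : mapping_space A M | evalmap g @` K `<=` N].
  exact: open_nbhs_nbhs (conj (mapping_space_open cK oN) fKN).
exists (B, [set g | evalmap g @` K `<=` N]); first by split.
move=> [b g] [/= Bb gKN] Qb.
have [db gb] : N (evalmap g b).
  by apply: gKN; exists b => //; split => //; exact: subset_closure.
split => //; move: gb; rewrite -ball_normE/= => gb.
have ga : `|phi (evalmap g b) - phi (evalmap f a)| <= e / 2 by rewrite distrC ltW.
rewrite -(subrK (phi (evalmap f a)) (phi (evalmap g b))) -addrA.
rewrite (le_trans (ler_normD _ _))// [e]splitr lerD// (le_trans (ltW Bb))//.
by lra.
Qed.

(** The image of [K] and [Q] in the chart is compact in the open image of [N], so it
has a positive distance to the complement. *)
Lemma chart_near_open (f : mapping_space A M) (Q K : set A) (N : set M) :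
  closed Q -> compact K -> open N ->
  (forall a, Q a -> chart_dom phi (evalmap f a)) -> evalmap f @` K `<=` N ->
  exists2 d : R, 0 < d & forall g : mapping_space A M, (forall a, Q a ->
    chart_dom phi (evalmap g a) /\ `|phi (evalmap g a) - phi (evalmap f a)| < d) ->
    forall a, Q a -> K a -> N (evalmap g a).
Proof.
move=> clQ cK oN Qd fKN.
have cKQ : compact (K `&` Q) by exact: compact_closedI.
have C : compact ((phi \o evalmap f) @` (K `&` Q)).
  by apply: chart_image_compact => //; [exact: evalmap_cts|move=> a [_ /Qd]].
have [|d d0 dP] := compact_tube C (chart_image_open phi oN).
  move=> _ [a [Ka Qa] <-]; exists (evalmap f a) => //; split; first exact: Qd.
  by apply: fKN; exists a.
exists d => // g gd a Qa Ka; have [dga gad] := gd a Qa.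
have [|y [dy Ny] yg] := dP (phi (evalmap f a)) _ _ gad; first by exists a.
by rewrite -(chart_funK dga) -yg chart_funK.
Qed.
End compact_source.

(** * Transition maps of an atlas *)

(** This is where the dimension of [M] has to be finite. *)
Lemma compact_neighborhood (R : realType) n (C U : set 'rV[R]_n) : compact C ->
  open U -> C `<=` U -> exists2 K, compact K /\ K `<=` U &
  exists2 d : R, 0 < d & forall c v, C c -> `|v - c| < d -> K v.
Proof.
move=> cC oU CU; have [d d0 dP] := compact_tube cC oU CU.
have d20 : 0 < d / 2 by rewrite divr_gt0.
pose N := [set v | exists2 c, C c & `|v - c| < d / 2].
exists (closure N); last first.
  exists (d / 2) => // c v Cc vc; apply: subset_closure; by exists c.
split; last first.
  move=> v clv; have [w [[c Cc wc]]] := clv _ (nbhsx_ballx v _ d20).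
  rewrite -ball_normE/= => vw; apply: (dP c) => //.
  rewrite -(subrK w v) -addrA (le_lt_trans (ler_normD _ _))//.
  by rewrite [d]splitr ltrD.
apply: bounded_closed_compact; last exact: closed_closure.
have [L [_ LP]] := compact_bounded cC.
have CL c : C c -> `|c| <= L + 1 by move=> Cc; apply: LP; rewrite ?ltrDl.
exists (L + 1 + d); split; first exact: num_real.
move=> x Lx v clv; have [w [[c Cc wc]]] := clv _ (nbhsx_ballx v _ d20).
rewrite -ball_normE/= => vw; rewrite (le_trans _ (ltW Lx))//.
rewrite -(subrK c v) addrC (le_trans (ler_normD _ _))// lerD ?CL//.
rewrite -(subrK w v) -addrA (le_trans (ler_normD _ _))//.
by rewrite [d]splitr lerD// ltW.
Qed.

Section atlas.
Context {R : realType} {M : topologicalType} {n : nat} {I : Type}.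
Local Notation V := 'rV[R]_n.
Variable atl : smooth_atlas M (fun _ : I => V).

Definition phi i : chart M V := atlas_chart atl i.
Definition adom i : set M := chart_dom (phi i).
Definition overlap i j : set V := phi i @` (adom i `&` adom j).
Definition tau i j : V -> V := phi j \o chart_inv (phi i).

Lemma overlap_open i j : open (overlap i j).
Proof. by apply: chart_image_open; exact: chart_dom_open. Qed.
Arguments overlap_open : clear implicits.

Lemma tauE i j x : adom i x -> tau i j (phi i x) = phi j x.
Proof. by move=> dx; rewrite /tau/= chart_funK. Qed.

Lemma tau_smooth i j : Cinfty (overlap i j) (tau i j).
Proof. exact: (atlas_compat atl). Qed.

(** The overlaps of three charts are compatible because [phi i] is injective. *)
Lemma tau_overlap i j k v : overlap i j v -> overlap i k v ->
  overlap j k (tau i j v).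
Proof.
move=> [x [ix jx] <-] [y [iy ky] yx].
have xy : y = x by rewrite -(chart_funK iy) yx chart_funK.
by exists x; [rewrite -xy in jx *; split|rewrite tauE].
Qed.

Lemma tau_tau i j k v : overlap i j v -> tau j k (tau i j v) = tau i k v.
Proof. by move=> [x [ix jx] <-]; rewrite !tauE. Qed.

Lemma dtau_exists i j : exists L : V -> clinear V V,
  forall v, overlap i j v -> is_diff v (tau i j) (L v).
Proof. by have [L [LP _]] := tau_smooth i j 1; exists L. Qed.

(** Outside the overlap the values are arbitrary. *)
Definition dtau i j : V -> clinear V V := projT1 (cid (dtau_exists i j)).

Lemma dtauP i j v : overlap i j v -> is_diff v (tau i j) (dtau i j v).
Proof. by rewrite /dtau; case: cid => L /=; exact. Qed.

Lemma dtau_cts i j v : overlap i j v -> {for v, continuous (dtau i j)}.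
Proof.
have [L [LP CL]] := tau_smooth i j 1.
have C0 : Ck 0 (overlap i j) (dtau i j).
  apply: (@Ck_congr _ 0 _ _ _ L) => //; first exact: overlap_open.
  by move=> w ow; exact: (is_diff_uniq (LP _ ow) (dtauP ow)).
exact: (Ck_continuous C0).
Qed.

Lemma dtau_cocycle i j k v u : overlap i j v -> overlap i k v ->
  dtau j k (tau i j v) (dtau i j v u) = dtau i k v u.
Proof.
move=> oij oik; have oo := open_nbhs_nbhs (conj (overlap_open i j) oij).
have := is_diff_comp (dtauP oij) (dtauP (tau_overlap oij oik)).
move=> dc.
have dik : is_diff v (tau i k) (clinear_comp (dtau j k (tau i j v)) (dtau i j v)).
  by apply: is_diff_near dc; apply: filterS oo => w; exact: tau_tau.
by rewrite -(is_diff_uniq dik (dtauP oik)).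
Qed.

Lemma dtau_id i v u : overlap i i v -> dtau i i v u = u.
Proof.
move=> oi; suff dii : is_diff v (tau i i) (clinear_id V).
  by rewrite (is_diff_uniq (dtauP oi) dii).
apply: is_diff_near (is_diff_clinear (clinear_id V) v).
apply: filterS (open_nbhs_nbhs (conj (overlap_open i i) oi)) => _ [x [ix _] <-].
by rewrite tauE.
Qed.

Context {A : topologicalType}.
Hypothesis cA : compact [set: A].

Lemma overlap_image_compact (f : A -> M) (Q : set A) i j : continuous f ->
  closed Q -> (forall a, Q a -> adom i (f a) /\ adom j (f a)) ->
  compact ((phi i \o f) @` Q) /\ (phi i \o f) @` Q `<=` overlap i j.
Proof.
move=> cf clQ Qd; split.
  apply: chart_image_compact => //; first exact: closed_compact.
  by move=> a /Qd[].
by move=> _ [a Qa <-]; exists (f a) => //; exact: Qd.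
Qed.

(** Smoothness of a change of coordinates near those of [f]: on the closed piece [Q]
the values of [phi i \o f] fill a compact subset of the overlap. *)
Lemma nemytskii_tau_smooth (X Y : Type) (h : Y -> X) (P : Y -> Prop)
    (w0 : bfun X V) (f : A -> M) (Q : set A) i j :
  continuous f -> closed Q -> (forall a, Q a -> adom i (f a) /\ adom j (f a)) ->
  (forall y, P y -> exists2 a, Q a & w0 (h y) = phi i (f a)) ->
  exists2 d : R, 0 < d & Cinfty (ball w0 d) (nemytskii h P (tau i j)) /\
  forall w, ball w0 d w -> forall y,
    nemytskii h P (tau i j) w y = if pselect (P y) then tau i j (w (h y)) else 0.
Proof.
move=> cf clQ Qd w0P; have [cC CU] := overlap_image_compact cf clQ Qd.
have [K [cK KU] [d d0 dP]] := compact_neighborhood cC (overlap_open i j) CU.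
have w0K y v : P y -> `|v - w0 (h y)| < d -> K v.
  by move=> /w0P[a Qa ->] va; apply: dP va; exists a.
exists d => //; split.
  by move=> k; apply: (nemytskii_Ck cK KU w0K); exact: tau_smooth.
move=> w wd y; exact: (nemytskiiE cK KU w0K _ (tau_smooth i j 0) wd).
Qed.
End atlas.
Arguments overlap_open {R M n I} atl i j.
Arguments tau_smooth {R M n I} atl i j.

(** * Finite families *)

Lemma finite_radius (R : realType) (T : finType) (Q : T -> R -> Prop) :
  (forall i (d d' : R), Q i d -> 0 < d' -> d' <= d -> Q i d') ->
  (forall i, exists2 d : R, 0 < d & Q i d) -> exists2 d : R, 0 < d & forall i, Q i d.
Proof.
move=> mono ex; have near0 i : \forall d \near (0 : R)^'+, Q i d.
  have [d d0 Qd] := ex i; near=> d'; apply: (mono _ _ _ Qd).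
    by near: d'; exact: nbhs_right_gt.
  by near: d'; exact: nbhs_right_le.
have [d [d0 dP]] := filter_ex (filterI (nbhs_right_gt (0 : R)) (filter_forall _ near0)).
by exists d.
Unshelve. all: end_near. Qed.

Lemma finite_bound (R : realType) (J : finType) (Q : J -> R -> Prop) :
  (forall i (d d' : R), Q i d -> d <= d' -> Q i d') ->
  (forall i, exists d : R, Q i d) -> exists d : R, forall i, Q i d.
Proof.
move=> mono /choice[d dQ]; exists (\sum_i `|d i|) => i; apply: mono (dQ i) _.
by rewrite (le_trans (ler_norm _))// (bigD1 i)//= lerDl sumr_ge0.
Qed.

Lemma bfun_sumE (R : realType) (X : Type) (V : normedModType R) (J : Type)
    (r : seq J) (P : pred J) (f : J -> bfun X V) y :
  (\sum_(i <- r | P i) f i) y = \sum_(i <- r | P i) f i y.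
Proof. by elim/big_rec2 : _ => // i u v _ <-. Qed.

Lemma is_diff_sum (R : realType) (E F : normedModType R) (J : Type) (r : seq J)
    (f : J -> E -> F) x (T : J -> clinear E F) :
  (forall i, is_diff x (f i) (T i)) ->
  is_diff x (fun y => \sum_(i <- r) f i y) (\sum_(i <- r) T i).
Proof.
move=> fT; elim: r => [|i r IH].
  rewrite big_nil; apply: is_diff_near (is_diff_cst 0 x).
  by apply: nearW => y; rewrite big_nil.
rewrite big_cons; apply: is_diff_near (is_diff_add (fT i) IH).
by apply: nearW => y; rewrite big_cons.
Qed.

Lemma cts_sum (R : realType) (T : topologicalType) (W : normedModType R)
    (J : Type) (q : seq J) (g : J -> T -> W) a :
  (forall i, {for a, continuous (g i)}) ->
  {for a, continuous (fun b => \sum_(i <- q) g i b)}.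
Proof.
move=> cg; elim: q => [|i q IH].
  rewrite (_ : (fun _ => _) = fun=> 0); first exact: cst_continuous.
  by apply/funext => b; rewrite big_nil.
rewrite (_ : (fun _ => _) = fun b => g i b + \sum_(k <- q) g k b); last first.
  by apply/funext => b; rewrite big_cons.
by apply: cvgD; [exact: cg|exact: IH].
Qed.

(** * Coordinates and displacements around a continuous map *)

Section chart_system.
Context {R : realType} {A M : topologicalType} {n : nat} {I : Type}.
Local Notation V := 'rV[R]_n.
Variable atl : smooth_atlas M (fun _ : I => V).
Local Notation phi := (phi atl).
Local Notation adom := (adom atl).
Local Notation overlap := (overlap atl).
Local Notation tau := (tau atl).
Local Notation dtau := (dtau atl).

(** The pieces are closed because [f] must fill a compact subset of a chart domain on
each of them, leaving room for the maps near [f]. The partition of unity serves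
to average the displacements measured in the different charts. *)
Record chart_system (f : mapping_space A M) := ChartSystem {
  cs_size : nat;
  cs_idx : 'I_cs_size -> I;
  cs_cl : 'I_cs_size -> set A;
  cs_closed : forall i, closed (cs_cl i);
  cs_adom : forall i a, cs_cl i a -> adom (cs_idx i) (evalmap f a);
  cs_rho : 'I_cs_size -> A -> R;
  cs_rho_cts : forall i, continuous (cs_rho i);
  cs_supp : forall i a, cs_rho i a != 0 -> cs_cl i a;
  cs_rho_sum : forall a, \sum_i cs_rho i a = 1 }.

Hypothesis cA : compact [set: A].

Section one_system.
Variables (f0 : mapping_space A M) (S : chart_system f0).
Local Notation N := (cs_size S).
Local Notation c := (@cs_idx _ S).
Local Notation cl := (@cs_cl _ S).
Local Notation rho := (@cs_rho _ S).
Let X : Type := (A * 'I_N)%type.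
Local Notation x0 := (evalmap f0).

Lemma cs_cover a : exists i, cl i a.
Proof.
apply: contrapT => /forallNP ncl; have := cs_rho_sum S a.
rewrite big1 => [/eqP|i _]; first by rewrite eq_sym oner_eq0.
by apply/eqP; apply/negP => /negP/cs_supp; exact: ncl.
Qed.

Lemma cs_rho0 i a : ~ cl i a -> rho i a = 0.
Proof. by move=> ncl; apply/eqP; apply/negP => /negP/cs_supp. Qed.

Definition admissible (f : mapping_space A M) :=
  forall j a, cl j a -> adom (c j) (evalmap f a).

(** A function on all of [A * 'I_N], zero at the pairs [(a, j)] with [a] outside the
piece [j]. *)
Definition coordinates (f : mapping_space A M) : bfun X V :=
  mkbfun (fun y : X => if pselect (cl y.2 y.1) then phi (c y.2) (evalmap f y.1) else 0).

Lemma coordinatesE f : admissible f -> forall y : X,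
  coordinates f y = if pselect (cl y.2 y.1) then phi (c y.2) (evalmap f y.1) else 0.
Proof.
move=> adf; have [L LP] : exists L : R, forall j a, cl j a ->
    `|phi (c j) (evalmap f a)| <= L.
  apply: (@finite_bound _ _ (fun j L => forall a, cl j a ->
    `|phi (c j) (evalmap f a)| <= L)).
    by move=> j d d' H dd' a /H /le_trans; apply.
  move=> j; have := chart_image_compact (@evalmap_cts _ _ f)
    (closed_compact cA (cs_closed (i := j))) (adf j).
  move=> /compact_bounded[L [_ LP]]; exists (L + 1) => a ca; apply: LP.
    by rewrite ltrDl.
  by exists a.
move=> y; rewrite /coordinates (@mkbfunE _ _ _ _ `|L|)// => -[a j] /=.
case: pselect => [ca|nca] /=; last by rewrite normr0.
by rewrite (le_trans (LP _ _ ca))// ler_norm.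
Qed.

Lemma coordinates_in f j a : admissible f -> cl j a ->
  coordinates f (a, j) = phi (c j) (evalmap f a).
Proof. by move=> adf ca; rewrite coordinatesE//=; case: pselect. Qed.

Lemma coordinates_out f j a : admissible f -> ~ cl j a -> coordinates f (a, j) = 0.
Proof. by move=> adf ca; rewrite coordinatesE//=; case: pselect. Qed.

Lemma admissible0 : admissible f0. Proof. by move=> j a; exact: cs_adom. Qed.

Local Notation w0 := (coordinates f0).

(** The vector at [f0 a], expressed in the chart [j], that points to the point with
coordinate [v] in that chart. The terms with [a] outside the piece [i] are
meaningless, and have weight zero. *)
Definition displacement (a : A) (j : 'I_N) (v : V) : V :=
  \sum_i rho i a *: dtau (c i) (c j) (phi (c i) (x0 a))
    (tau (c j) (c i) v - phi (c i) (x0 a)).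

(** The identity at the irrelevant pairs keeps the differential at the coordinates of
[f0] equal to the identity. *)
Definition displacement_field (w : bfun X V) : bfun X V :=
  mkbfun (fun y : X =>
    if pselect (cl y.2 y.1) then displacement y.1 y.2 (w y) else w y).

Lemma base_overlap i j a : cl i a -> cl j a -> overlap (c i) (c j) (phi (c i) (x0 a)).
Proof. by move=> ia ja; exists (x0 a) => //; split; exact: cs_adom. Qed.

(** [displacement_field] is a sum over pairs [(i, j)] of composition operators with
[tau_ji], multiplied by these coefficients, up to a constant; [keep] restores the
identity at the irrelevant pairs. *)
Let coef_fun i j (y : X) : clinear V V :=
  if pselect [/\ y.2 = j, cl j y.1 & cl i y.1] then
    rho i y.1 *: dtau (c i) (c j) (phi (c i) (x0 y.1)) else 0.

Let coef i j : bfun X (clinear V V) := mkbfun (coef_fun i j).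

Lemma coefE i j y : coef i j y = coef_fun i j y.
Proof.
have clij : closed (cl i `&` cl j) by apply: closedI; exact: cs_closed.
have [L LP] : exists L : R, forall a, (cl i `&` cl j) a ->
    `|rho i a *: dtau (c i) (c j) (phi (c i) (x0 a))| <= L.
  apply: compact_bound; first exact: closed_compact.
  apply: continuous_in_subspaceT => a /set_mem[ia ja].
  apply: cvgZ; first exact: cs_rho_cts.
  apply: (@continuous_comp _ _ _ (phi (c i) \o x0) (dtau (c i) (c j))).
    by apply: chart_comp_cts; [exact: evalmap_cts|exact: cs_adom].
  by apply: dtau_cts; exact: base_overlap.
rewrite /coef (@mkbfunE _ _ _ _ `|L|)// => z; rewrite /coef_fun.
case: pselect => [[zj ja ia]|nP] /=; last by rewrite normr0.
by rewrite (le_trans (LP _ _))// ler_norm.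
Qed.

Let P i j (y : X) := [/\ y.2 = j, cl j y.1 & cl i y.1].
Let nem (p : 'I_N * 'I_N) : bfun X V -> bfun X V :=
  nemytskii id (P p.1 p.2) (tau (c p.2) (c p.1)).
Let keep : bfun X (clinear V V) :=
  mkbfun (fun y : X => if pselect (cl y.2 y.1) then 0 else clinear_id V).
Let keepE y : keep y = if pselect (cl y.2 y.1) then 0 else clinear_id V.
Proof.
rewrite /keep (@mkbfunE _ _ _ _ 1)// => z; case: pselect => _ /=.
  by rewrite normr0 ler01.
by apply: opnorm_le_bound => // v; rewrite mul1r.
Qed.
Let summand p w := bfun_mult id (coef p.1 p.2) (nem p w).
Let Fsum w := \sum_p summand p w + (- (\sum_p summand p w0) + bfun_mult id keep w).

Lemma nem_radius : exists2 d : R, 0 < d & forall p : 'I_N * 'I_N,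
  Cinfty (ball w0 d) (nem p) /\
  forall w, ball w0 d w -> forall y,
    nem p w y = if pselect (P p.1 p.2 y) then tau (c p.2) (c p.1) (w y) else 0.
Proof.
apply: finite_radius => [p d d' [Cd nd] d'0 d'd|[i j]].
  have sub : ball w0 d' `<=` ball w0 d by apply: le_ball.
  split; first by move=> k; exact: Ck_subset (Cd k).
  by move=> w /sub; exact: nd.
apply: (@nemytskii_tau_smooth _ _ _ _ atl _ cA _ _ id (P i j) w0 x0 (cl i `&` cl j)).
- exact: evalmap_cts.
- by apply: closedI; exact: cs_closed.
- by move=> a [ia ja]; split; exact: cs_adom.
- move=> [a j'] [/= -> ja ia]; exists a => //.
  by rewrite coordinates_in//; exact: admissible0.
Qed.

Let Fsum_in w a j d : ball w0 d w -> 0 < d -> cl j a ->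
  (forall p w, ball w0 d w -> forall y,
    nem p w y = if pselect (P p.1 p.2 y) then tau (c p.2) (c p.1) (w y) else 0) ->
  Fsum w (a, j) = displacement a j (w (a, j)).
Proof.
move=> wd d0 ja nemP.
have sE w' : ball w0 d w' -> (\sum_p summand p w') (a, j) =
    \sum_i (if pselect (cl i a) then rho i a *: dtau (c i) (c j) (phi (c i) (x0 a))
       (tau (c j) (c i) (w' (a, j))) else 0).
  move=> wd'; rewrite bfun_sumE.
  rewrite -(pair_bigA _ (fun i j' => summand (i, j') w' (a, j)))/=.
  apply: eq_bigr => i _; rewrite (bigD1 j)//= big1 ?addr0 => [|j' j'j].
    rewrite /summand bfun_multE coefE /coef_fun (nemP _ _ wd' _)/=.
    case: (pselect (cl i a)) => ia; case: pselect => [[]|nP] //=.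
    by exfalso; apply: nP.
  rewrite /summand bfun_multE coefE /coef_fun; case: pselect => [[/= jj']|//].
  by rewrite jj' eqxx in j'j.
have kE : (bfun_mult id keep w) (a, j) = 0.
  by rewrite bfun_multE keepE/=; case: pselect.
rewrite /Fsum bfunDE sE// bfunDE kE addr0 bfunNE sE; last exact: ballxx.
rewrite -sumrB /displacement; apply: eq_bigr => i _.
case: pselect => [ia|nia] /=; last by rewrite cs_rho0// scale0r subrr.
rewrite linearB/= -scalerBr; congr (_ *: (_ - dtau _ _ _ _)).
rewrite coordinates_in//; first by rewrite tauE//; exact: cs_adom.
exact: admissible0.
Qed.

Let Fsum_out w a j d : ball w0 d w -> 0 < d -> ~ cl j a ->
  (forall p w, ball w0 d w -> forall y,
    nem p w y = if pselect (P p.1 p.2 y) then tau (c p.2) (c p.1) (w y) else 0) ->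
  Fsum w (a, j) = w (a, j).
Proof.
move=> wd d0 nja nemP.
have sE w' : ball w0 d w' -> (\sum_p summand p w') (a, j) = 0.
  move=> wd'; rewrite bfun_sumE big1// => p _.
  rewrite /summand bfun_multE coefE /coef_fun; case: pselect => [[/= <- //]|//].
have kE : (bfun_mult id keep w) (a, j) = w (a, j).
  by rewrite bfun_multE keepE/=; case: pselect.
by rewrite /Fsum bfunDE sE// bfunDE kE bfunNE sE ?oppr0 ?add0r//; exact: ballxx.
Qed.

Lemma displacement_field_smooth : exists2 d : R, 0 < d &
  Cinfty (ball w0 d) displacement_field /\
  forall w, ball w0 d w -> forall y : X, displacement_field w y =
    if pselect (cl y.2 y.1) then displacement y.1 y.2 (w y) else w y.
Proof.
have [d d0 nemP] := nem_radius; exists d => //.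
have nP p w wd y := (nemP p).2 w wd y.
have FE w : ball w0 d w -> displacement_field w = Fsum w.
  move=> wd; have E : (fun y : X =>
      if pselect (cl y.2 y.1) then displacement y.1 y.2 (w y) else w y)
      = Fsum w.
    apply/funext => -[a j]; case: pselect => [ja|nja] /=.
      exact: (esym (@Fsum_in w a j d wd d0 ja nP)).
    exact: (esym (@Fsum_out w a j d wd d0 nja nP)).
  apply: bfunP => y; rewrite /displacement_field E (@mkbfunE _ _ _ _ `|Fsum w|)//.
  exact: bfun_le.
split.
- move=> k; apply: (@Ck_congr _ k _ _ _ Fsum); first exact: ball_open.
    by move=> w /FE.
  apply: Ck_add.
    apply: Ck_sum => p; apply: Ck_postcomp; exact: (nemP p).1.
  by apply: Ck_add; [exact: Ck_cst|exact: Ck_clinear].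
- move=> w wd [a j]; rewrite FE//; case: pselect => [ja|nja] /=.
    exact: (@Fsum_in w a j d wd d0 ja nP).
  exact: (@Fsum_out w a j d wd d0 nja nP).
Qed.

(** The differentials of [tau_ij] and [tau_ji] cancel in each term, and the weights sum
to one. *)
Lemma displacement_diff a j : cl j a ->
  is_diff (phi (c j) (x0 a)) (displacement a j) (clinear_id V).
Proof.
move=> ja.
have -> : clinear_id V = \sum_i rho i a *: clinear_id V.
  by rewrite -scaler_suml cs_rho_sum scale1r.
apply: is_diff_sum => i; have [r0|/cs_supp ia] := eqVneq (rho i a) 0.
  rewrite [X in is_diff _ X](_ : _ = fun=> 0); last first.
    by apply/funext => v; rewrite r0 scale0r.
  by rewrite r0 scale0r; exact: is_diff_cst.
set v0 := phi (c j) (x0 a).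
have oji : overlap (c j) (c i) v0 by exact: base_overlap.
pose L := rho i a *: dtau (c i) (c j) (phi (c i) (x0 a)).
have dN := is_diff_add (dtauP oji) (is_diff_cst (- phi (c i) (x0 a)) v0).
have := is_diff_comp dN (is_diff_clinear L _).
suff -> : clinear_comp L (dtau (c j) (c i) v0 + 0) = rho i a *: clinear_id V by [].
apply: clinearP => u; rewrite addr0 clinear_compE /L !clinearZE clinear_idE.
have tv : tau (c j) (c i) v0 = phi (c i) (x0 a) by rewrite tauE//; exact: cs_adom.
by rewrite -tv dtau_cocycle ?dtau_id//; exact: base_overlap.
Qed.

Let eval (y : X) : clinear (bfun X V) V.
Proof.
apply: (@mkclinear _ _ _ (fun w : bfun X V => w y) _ 1) => [a u v|u].
  by rewrite bfunDE bfunZE.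
by rewrite mul1r bfun_le.
Defined.

(** Enough to compare the values at each pair, where the operator is [displacement]. *)
Lemma displacement_field_diff : is_diff w0 displacement_field (clinear_id (bfun X V)).
Proof.
have [d d0 [CF FE]] := displacement_field_smooth.
have [DF [dDF _]] := CF 1%N; have dF := dDF _ (ballxx w0 d0).
suff <- : DF w0 = clinear_id _ by [].
apply: clinearP => u; apply: bfunP => -[a j].
have dFy := is_diff_comp dF (is_diff_clinear (eval (a, j)) _).
have nd : \forall w \near w0, ball w0 d w by exact: nbhsx_ballx.
have [ja|nja] := pselect (cl j a).
  have dG : is_diff (eval (a, j) w0) (displacement a j) (clinear_id V).
    rewrite (_ : eval (a, j) w0 = phi (c j) (x0 a)); first exact: displacement_diff.
    by rewrite /eval/= coordinates_in//; exact: admissible0.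
  have dG' := is_diff_comp (is_diff_clinear (eval (a, j)) w0) dG.
  have dG2 : is_diff w0 (eval (a, j) \o displacement_field)
      (clinear_comp (clinear_id V) (eval (a, j))).
    apply: is_diff_near dG'; apply: filterS nd => w wd /=.
    by rewrite /eval/= FE//=; case: pselect.
  by have /(congr1 (fun T : clinear _ _ => T u)) := is_diff_uniq dFy dG2.
have dG2 : is_diff w0 (eval (a, j) \o displacement_field) (eval (a, j)).
  apply: is_diff_near (is_diff_clinear (eval (a, j)) w0); apply: filterS nd => w wd /=.
  by rewrite /eval/= FE//=; case: pselect.
by have /(congr1 (fun T : clinear _ _ => T u)) := is_diff_uniq dFy dG2.
Qed.

(** On the ball of radius [rad_r] the inverse function theorem applies. Within the
smaller radius [rad_s], values still lie in that ball after a change of chart;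
this is what allows injectivity to compare values in different charts. *)
Record radii := Radii {
  rad_r : R;
  rad_s : R;
  rad_s_gt0 : 0 < rad_s;
  rad_sr : rad_s <= rad_r;
  rad_FE : forall w, `|w - w0| <= rad_r -> forall y : X,
    displacement_field w y =
      if pselect (cl y.2 y.1) then displacement y.1 y.2 (w y) else w y;
  rad_smooth : Cinfty (ball w0 rad_r) displacement_field;
  rad_id : near_identity displacement_field w0 rad_r;
  rad_inv : forall (O : set (bfun X V)) (H : bfun X V -> bfun X V), open O ->
    (forall w, O w -> `|w - w0| < rad_r) ->
    (forall w, O w -> H (displacement_field w) = w) ->
    Cinfty (displacement_field @` O) H;
  rad_overlap : forall i j a v, cl i a -> cl j a ->
    `|v - phi (c i) (x0 a)| < rad_s -> overlap (c i) (c j) v /\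
    `|tau (c i) (c j) v - phi (c j) (x0 a)| <= rad_r }.

Lemma radii_exist : inhabited radii.
Proof.
have [d d0 [CF FE]] := displacement_field_smooth.
have [r r0 [rd Fid Finv]] :=
  inverse_function (ball_open w0 d) (ballxx w0 d0) CF displacement_field_diff.
have [s s0 sP] : exists2 s : R, 0 < s & forall p : 'I_N * 'I_N, forall a v,
    cl p.1 a -> cl p.2 a -> `|v - phi (c p.1) (x0 a)| < s ->
    overlap (c p.1) (c p.2) v /\
    `|tau (c p.1) (c p.2) v - phi (c p.2) (x0 a)| <= r.
  apply: (@finite_radius _ _ (fun p s => forall a v, _ -> _ -> _ < s -> _)).
    by move=> p e e' He e'0 e'e a v ia ja vs; apply: He => //; exact: lt_le_trans e'e.
  move=> [i j] /=.
  have clij : closed (cl i `&` cl j) by apply: closedI; exact: cs_closed.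
  have ijd a : (cl i `&` cl j) a -> adom (c i) (x0 a) /\ adom (c j) (x0 a).
    by move=> [ia ja]; split; exact: cs_adom.
  have [cC CO] := overlap_image_compact cA (@evalmap_cts _ _ f0) clij ijd.
  have [s1 s10 s1P] := compact_tube cC (overlap_open atl (c i) (c j)) CO.
  have [|s2 s20 s2P] := @compact_unif_cts _ _ _ _ (tau (c i) (c j)) cC _ r r0.
    by move=> v /CO; exact: (Ck_continuous (tau_smooth atl (c i) (c j) 0)).
  exists (Num.min s1 s2); first by rewrite lt_min s10.
  move=> a v ia ja; rewrite lt_min => /andP[v1 v2].
  split; first by apply: s1P v1; exists a.
  rewrite -[X in `|_ - X|](tauE (c j) (cs_adom ia)).
  by apply: s2P => //; exists a.
constructor; apply: (@Radii r (Num.min s r)).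
- by rewrite lt_min s0.
- by rewrite ge_min lexx orbT.
- by move=> w wr; apply: FE; exact: rd.
- move=> k; apply: Ck_subset (CF k) => w wr; apply: rd.
  by rewrite distrC ltW//; rewrite -ball_normE in wr.
- exact: Fid.
- exact: Finv.
- move=> i j a v ia ja; rewrite lt_min => /andP[vs _]; exact: (sP (i, j)).
Qed.

End one_system.
End chart_system.

Arguments rad_FE {R A M n I atl f0 S} r w _ y.
Arguments rad_id {R A M n I atl f0 S} r.
Arguments rad_smooth {R A M n I atl f0 S} r k.

(** * Tangent vector fields along a continuous map *)

Section chart_at.
Context {R : realType} {A M : topologicalType} {n : nat} {I : Type}.
Local Notation V := 'rV[R]_n.
Variable atl : smooth_atlas M (fun _ : I => V).
Local Notation phi := (phi atl).
Local Notation adom := (adom atl).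
Local Notation overlap := (overlap atl).
Local Notation tau := (tau atl).
Local Notation dtau := (dtau atl).
Hypothesis cA : compact [set: A].

Variables (f0 : mapping_space A M) (S : chart_system atl f0).
Local Notation N := (cs_size S).
Local Notation c := (@cs_idx _ _ _ _ _ _ _ S).
Local Notation cl := (@cs_cl _ _ _ _ _ _ _ S).
Local Notation rho := (@cs_rho _ _ _ _ _ _ _ S).
Let X : Type := (A * 'I_N)%type.
Local Notation x0 := (evalmap f0).
Local Notation w0 := (coordinates S f0).
Local Notation F := (displacement_field (S := S)).
Local Notation G := (displacement (S := S)).

Variable rad : radii S.
Local Notation r := (rad_r rad).
Local Notation s := (rad_s rad).

Let spike (y : X) (v : V) : bfun X V :=
  mkbfun (fun z : X => if pselect (z = y) then v else 0).

Let spikeE y v z : spike y v z = if pselect (z = y) then v else 0.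
Proof.
rewrite /spike (@mkbfunE _ _ _ _ `|v|)// => t.
by case: pselect => _ //=; rewrite normr0.
Qed.

Let spike_norm y v : `|spike y v| <= `|v|.
Proof.
apply/bfun_normP => // z; rewrite spikeE.
by case: pselect => _ //=; rewrite normr0.
Qed.

(** Apply the expansion estimate for the whole operator to two functions that differ
from the coordinates of [f0] only at [(a, j)]. *)
Lemma displacement_expand j a v v' : cl j a -> `|v - phi (c j) (x0 a)| <= r ->
  `|v' - phi (c j) (x0 a)| <= r -> `|v - v'| <= 2 * `|G a j v - G a j v'|.
Proof.
move=> ja; have coordinates0 : w0 (a, j) = phi (c j) (x0 a).
  by rewrite coordinates_in//; exact: admissible0.
rewrite -coordinates0 => vr v'r.
have [w [wr wE wO]] : exists w : V -> bfun X V,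
    [/\ forall u, `|u - w0 (a, j)| <= r -> `|w u - w0| <= r,
    forall u, w u (a, j) = u & forall u z, z <> (a, j) -> w u z = w0 z].
  exists (fun u => w0 + spike (a, j) (u - w0 (a, j))); split=> [u ur|u|u z zaj].
  - by rewrite addrAC subrr add0r (le_trans (spike_norm _ _)).
  - by rewrite bfunDE spikeE; case: pselect => //= _; rewrite addrC subrK.
  - by rewrite bfunDE spikeE; case: pselect => //= _; rewrite addr0.
have FG u : `|u - w0 (a, j)| <= r -> F (w u) (a, j) = G a j u.
  move=> ur; have := rad_FE rad _ (wr _ ur) (a, j).
  by case: pselect => //= _ ->; rewrite wE.
have FO z : z <> (a, j) -> F (w v) z = F (w v') z.
  move=> zaj; have := rad_FE rad _ (wr _ vr) z; have := rad_FE rad _ (wr _ v'r) z.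
  by rewrite !(wO _ z zaj) => -> ->.
have vv' : `|v - v'| <= `|w v - w v'|.
  by have := bfun_le (w v - w v') (a, j); rewrite bfunBE !wE.
have FF : `|F (w v) - F (w v')| <= `|G a j v - G a j v'|.
  apply/bfun_normP => // z; rewrite bfunBE.
  have [->|zaj] := pselect (z = (a, j)); first by rewrite (FG v vr) (FG v' v'r).
  by rewrite (FO z zaj) subrr normr0.
rewrite (le_trans vv')//.
rewrite (le_trans (near_identity_expand (rad_id rad) (wr _ vr) (wr _ v'r)))//.
by rewrite ler_wpM2l.
Qed.

Definition cts_on (Q : set A) (g : A -> V) := forall a0, Q a0 ->
  forall e : R, 0 < e -> \forall a \near a0, Q a -> `|g a - g a0| <= e.

Lemma cts_on_eq (Q : set A) (g h : A -> V) :
  (forall a, Q a -> {for a, continuous g}) -> (forall a, Q a -> h a = g a) ->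
  cts_on Q h.
Proof.
move=> cg hg a0 Qa0 e e0; have /cvgrPdist_le/(_ e e0) := cg _ Qa0.
by apply: filterS => a ga Qa; rewrite !hg// distrC.
Qed.

(** Outside the closed piece [i] the weight vanishes identically, whatever [g] is. *)
Lemma cs_rho_scale_cts i a (g : A -> V) : (cl i a -> {for a, continuous g}) ->
  {for a, continuous (fun b => rho i b *: g b)}.
Proof.
move=> cg; have [ia|nia] := pselect (cl i a).
  by apply: cvgZ; [exact: cs_rho_cts|exact: cg].
have nn : \forall b \near a, ~ cl i b.
  apply: (@open_nbhs_nbhs _ a (~` cl i)); split => //.
  by apply: closed_openC; exact: cs_closed.
rewrite /prop_for /continuous_at cs_rho0// scale0r.
apply: (@cvg_trans _ ((fun=> 0) @ a)); last exact: cvg_cst.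
by apply: near_eq_cvg; apply: filterS nn => b nib; rewrite cs_rho0// scale0r.
Qed.

(** A continuous tangent vector field along [f0], given by its components in all
charts: these vanish off their piece and are related by the differentials of the
transition maps. *)
Definition tangent_pred : {pred bfun X V} := [pred xi : bfun X V | `[<
  [/\ forall j a, ~ cl j a -> xi (a, j) = 0,
      forall i j a, cl i a -> cl j a ->
        xi (a, j) = dtau (c i) (c j) (phi (c i) (x0 a)) (xi (a, i)) &
      forall j, cts_on (cl j) (fun a => xi (a, j))] >]].

Lemma tangent_submod : submod_closed tangent_pred.
Proof.
split.
  apply/asboolP; split => [//|i j a _ _|j a0 _ e e0]; first by rewrite linear0.
  by apply: nearW => a _; rewrite subrr normr0 ltW.
move=> k u v /asboolP[u1 u2 u3] /asboolP[v1 v2 v3]; apply/asboolP; split.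
- by move=> j a nja; rewrite bfunDE bfunZE u1// v1// scaler0 addr0.
- move=> i j a ia ja; rewrite !bfunDE !bfunZE (u2 i)// (v2 i)//.
  by rewrite linearP.
- move=> j a0 ja0 e e0.
  have k0 : 0 < `|k| + 1 by rewrite ltr_wpDl.
  have e1 : 0 < e / 2 / (`|k| + 1) by rewrite !divr_gt0.
  have e2 : 0 < e / 2 by rewrite divr_gt0.
  apply: filter_app (u3 j _ ja0 _ e1); apply: filterS (v3 j _ ja0 _ e2) => a va ua ja.
  rewrite !bfunDE !bfunZE opprD addrACA -scalerBr (le_trans (ler_normD _ _))//.
  rewrite [e]splitr lerD//; last exact: va.
  rewrite normrZ (@le_trans _ _ ((`|k| + 1) * (e / 2 / (`|k| + 1))))//.
    by rewrite ler_pM// ?lerDl// ua.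
  by rewrite mulrC divfK ?gt_eqF.
Qed.

Lemma tangent_closed : closed [set xi | xi \in tangent_pred].
Proof.
move=> xi clxi.
have app (e : R) : 0 < e -> exists2 u, u \in tangent_pred & `|xi - u| <= e.
  move=> e0; have [u [/= ut]] := clxi _ (nbhsx_ballx xi _ e0).
  by rewrite -ball_normE/= => xu; exists u => //; exact: ltW.
have le0 (x : V) (K : R) : (forall e : R, 0 < e -> `|x| <= K * e) -> x = 0.
  move=> H; apply/normr0_eq0/le_anti; rewrite normr_ge0 andbT.
  apply/ler_addgt0Pr => e e0; rewrite add0r.
  have K0 : 0 < `|K| + 1 by rewrite ltr_wpDl.
  rewrite (le_trans (H _ (divr_gt0 e0 K0)))// mulrA ler_pdivrMr// mulrC ler_wpM2l//.
    exact: ltW.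
  by rewrite (le_trans (ler_norm _))// lerDl.
apply/asboolP; split.
- move=> j a nja; apply: (le0 _ 1) => e e0.
  have [u /asboolP[u1 _ _] xu] := app e e0.
  by rewrite mul1r -[xi _]subr0 -(u1 _ _ nja) -bfunBE (le_trans (bfun_le _ _)).
- move=> i j a ia ja; set L := dtau _ _ _; apply/eqP; rewrite -subr_eq0; apply/eqP.
  apply: (le0 _ (1 + `|L|)) => e e0.
  have [u /asboolP[_ u2 _] xu] := app e e0.
  have -> : xi (a, j) - L (xi (a, i)) = (xi - u) (a, j) - L ((xi - u) (a, i)).
    by rewrite !bfunBE linearB/= (u2 i j a ia ja) -/L opprB addrA subrK.
  rewrite (le_trans (ler_normB _ _))// mulrDl mul1r lerD//.
    by rewrite (le_trans (bfun_le _ _)).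
  by rewrite (le_trans (clinear_le _ _))// ler_wpM2l// (le_trans (bfun_le _ _)).
- move=> j a0 ja0 e e0; have e3 : 0 < e / 3 by rewrite divr_gt0.
  have [u /asboolP[_ _ u3] xu] := app _ e3.
  apply: filterS (u3 j _ ja0 _ e3) => a ua ja.
  have -> : xi (a, j) - xi (a0, j) =
    (xi - u) (a, j) + ((u (a, j) - u (a0, j)) - (xi - u) (a0, j)).
    by rewrite !bfunBE opprB [X in _ = _ + X]addrA subrK addrA subrK.
  rewrite (le_trans (ler_normD _ _))//.
  have -> : e = e / 3 + (e / 3 + e / 3) by field.
  rewrite lerD//; first by rewrite (le_trans (bfun_le _ _)).
  rewrite (le_trans (ler_normB _ _))// lerD//; first exact: ua.
  by rewrite (le_trans (bfun_le _ _)).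
Qed.

Definition tangent : closed_submodule (bfun X V) :=
  ClosedSubmodule tangent_submod tangent_closed.



Lemma coordinates0 j a : cl j a -> w0 (a, j) = phi (c j) (x0 a).
Proof. by move=> ja; rewrite coordinates_in//; exact: admissible0. Qed.

(** By the cocycle rule, a weighted sum of vectors expressed in the chart [i] is
transported to the chart [j] term by term. *)
Lemma dtau_sum (i j : 'I_N) a (u : 'I_N -> V) : cl i a -> cl j a ->
  dtau (c i) (c j) (phi (c i) (x0 a))
    (\sum_m rho m a *: dtau (c m) (c i) (phi (c m) (x0 a)) (u m)) =
  \sum_m rho m a *: dtau (c m) (c j) (phi (c m) (x0 a)) (u m).
Proof.
move=> ia ja; rewrite linear_sum; apply: eq_bigr => m _ /=.
have [->|/cs_supp ma] := eqVneq (rho m a) 0; first by rewrite !scale0r linear0.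
rewrite linearZ/=; congr (_ *: _).
have <- : tau (c m) (c i) (phi (c m) (x0 a)) = phi (c i) (x0 a).
  by rewrite tauE//; exact: cs_adom.
by rewrite dtau_cocycle//; exact: base_overlap.
Qed.

Lemma displacement_frame (i j : 'I_N) a v : cl i a -> cl j a -> overlap (c i) (c j) v ->
  G a j (tau (c i) (c j) v) = dtau (c i) (c j) (phi (c i) (x0 a)) (G a i v).
Proof.
move=> ia ja ov; rewrite dtau_sum//; apply: eq_bigr => m _.
by rewrite tau_tau.
Qed.

Lemma displacement_phi (j : 'I_N) a y : adom (c j) y -> G a j (phi (c j) y) =
  \sum_i rho i a *: dtau (c i) (c j) (phi (c i) (x0 a))
    (phi (c i) y - phi (c i) (x0 a)).
Proof. by move=> dy; apply: eq_bigr => i _; rewrite tauE. Qed.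

Lemma dtau_phi_cts (i j : 'I_N) a : cl i a -> cl j a ->
  {for a, continuous (fun b => dtau (c i) (c j) (phi (c i) (x0 b)))}.
Proof.
move=> ia ja.
apply: (@continuous_comp _ _ _ (phi (c i) \o x0) (dtau (c i) (c j))).
  by apply: chart_comp_cts; [exact: evalmap_cts|exact: cs_adom].
by apply: dtau_cts; exact: base_overlap.
Qed.

Lemma phi_cts (f : mapping_space A M) (i : 'I_N) a : admissible S f -> cl i a ->
  {for a, continuous (fun b => phi (c i) (evalmap f b))}.
Proof.
by move=> adf ia; apply: chart_comp_cts; [exact: evalmap_cts|exact: adf].
Qed.

Lemma displacement_cts (j : 'I_N) a v : cl j a ->
  {for a, continuous (fun b => G b j v)}.
Proof.
move=> ja; apply: cts_sum => i; apply: cs_rho_scale_cts => ia.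
apply: cvg_clinear_app; first exact: dtau_phi_cts.
apply: cvgB; first exact: cvg_cst.
by apply: phi_cts => //; exact: admissible0.
Qed.

Lemma displacement_field_tangent f : admissible S f -> `|coordinates S f - w0| <= r ->
  F (coordinates S f) \in tangent_pred.
Proof.
move=> adf fr.
have Fin j a : cl j a -> F (coordinates S f) (a, j) = \sum_i rho i a *:
    dtau (c i) (c j) (phi (c i) (x0 a)) (phi (c i) (evalmap f a) - phi (c i) (x0 a)).
  move=> ja; have := rad_FE rad _ fr (a, j); case: pselect => //= _ ->.
  by rewrite coordinates_in// displacement_phi//; exact: adf.
apply/asboolP; split.
- move=> j a nja; have := rad_FE rad _ fr (a, j); case: pselect => //= _ ->.
  by rewrite coordinates_out.
- by move=> i j a ia ja; rewrite !Fin// dtau_sum.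
- move=> j; apply: cts_on_eq (Fin j) => a ja; apply: cts_sum => i.
  apply: cs_rho_scale_cts => ia; apply: cvg_clinear_app.
    exact: dtau_phi_cts.
  by apply: cvgB; apply: phi_cts => //; exact: admissible0.
Qed.

(** The functions near [w0] with a tangent displacement are exactly the coordinates of
continuous maps. The two steps are [compat], that the values of [w] in different
charts are those of one point, and [wc], that they depend continuously on [a]. *)
Lemma tangent_section w : `|w - w0| < s -> F w \in tangent_pred ->
  exists2 f, admissible S f & coordinates S f = w.
Proof.
move=> ws /asboolP[Fw0 Fwij Fwc].
have wr : `|w - w0| <= r by rewrite (le_trans (ltW ws))// rad_sr.
have wyr j a : cl j a -> `|w (a, j) - phi (c j) (x0 a)| < s.
  by move=> ja; rewrite -coordinates0// -bfunBE (le_lt_trans _ ws)// bfun_le.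
have Fin j a : cl j a -> F w (a, j) = G a j (w (a, j)).
  by move=> ja; have := rad_FE rad _ wr (a, j); case: pselect.
(* both sides lie within [rad_r] of the base point and have the same displacement *)
have compat i j a : cl i a -> cl j a -> tau (c i) (c j) (w (a, i)) = w (a, j).
  move=> ia ja; have [ov tr] := rad_overlap ia ja (wyr i a ia).
  apply/eqP; rewrite -subr_eq0 -normr_eq0; apply/eqP/le_anti; rewrite normr_ge0 andbT.
  have wjr : `|w (a, j) - phi (c j) (x0 a)| <= r.
    by rewrite (le_trans (ltW (wyr _ _ ja)))// rad_sr.
  rewrite (le_trans (displacement_expand ja tr wjr))//.
  by rewrite displacement_frame// -!Fin// -Fwij// subrr normr0 mulr0.
have [k kP] := choice (cs_cover S).
pose g0 a := chart_inv (phi (c (k a))) (w (a, k a)).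
have gE j a : cl j a -> adom (c j) (g0 a) /\ phi (c j) (g0 a) = w (a, j).
  move=> ja; have [[y [iy jy] yw] _] := rad_overlap (kP a) ja (wyr _ _ (kP a)).
  have g0y : g0 a = y by rewrite /g0 -yw chart_funK.
  by rewrite g0y; split => //; rewrite -(compat _ _ _ (kP a) ja) -yw tauE.
(* [w (a, j)] and [w (a0, j)] are compared through their displacements from [f0 a] *)
have wc j : cts_on (cl j) (fun a => w (a, j)).
  move=> a0 ja0 e e0; have e4 : 0 < e / 4 by rewrite divr_gt0.
  have near_s : \forall a \near a0, `|w (a0, j) - phi (c j) (x0 a)| < s.
    have : (fun a => `|w (a0, j) - phi (c j) (x0 a)|) @ a0 -->
        `|w (a0, j) - phi (c j) (x0 a0)|.
      apply: cvg_norm; apply: cvgB; first exact: cvg_cst.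
      by apply: phi_cts => //; exact: admissible0.
    by move=> /cvgr_lt; apply; exact: wyr.
  have near_G : \forall a \near a0, `|G a0 j (w (a0, j)) - G a j (w (a0, j))| <= e / 4.
    have /cvgrPdist_le := displacement_cts (v := w (a0, j)) ja0; exact.
  apply: filter_app (Fwc j a0 ja0 _ e4); apply: filter_app near_G.
  apply: filterS near_s => a sa Ga Fa ja.
  have war : `|w (a, j) - phi (c j) (x0 a)| <= r.
    by rewrite (le_trans (ltW (wyr _ _ ja)))// rad_sr.
  have wa0r : `|w (a0, j) - phi (c j) (x0 a)| <= r.
    by rewrite (le_trans (ltW sa))// rad_sr.
  rewrite (le_trans (displacement_expand ja war wa0r))// -Fin//.
  have -> : F w (a, j) - G a j (w (a0, j)) =
      (F w (a, j) - F w (a0, j)) + (G a0 j (w (a0, j)) - G a j (w (a0, j))).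
    by rewrite addrA -(Fin _ _ ja0) subrK.
  have := ler_normD (F w (a, j) - F w (a0, j))
    (G a0 j (w (a0, j)) - G a j (w (a0, j))).
  have := Fa ja; move: Ga.
  set x1 := `| _ |; set x2 := `| _ |; set x3 := `| _ |.
  by lra.
have cf : continuous g0.
  move=> a0 B /= nB; suff nj j : \forall a \near a0, cl j a -> B (g0 a).
    suff : nbhs a0 [set a | B (g0 a)] by [].
    by apply: filterS (filter_forall _ nj) => a Ba; exact: Ba (k a) (kP a).
  have [ja0|nja0] := pselect (cl j a0); last first.
    apply: (@filterS _ _ _ (~` cl j)); first by move=> a nja /nja.
    apply: (@open_nbhs_nbhs _ a0 (~` cl j)); split => //.
    by apply: closed_openC; exact: cs_closed.
  have [da0 ga0] := gE _ _ ja0.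
  have img : (phi (c j) @` chart_dom (phi (c j))) (w (a0, j)) by exists (g0 a0).
  have := chart_inv_cts img; rewrite /prop_for /continuous_at -{2}ga0 chart_funK//.
  move=> /(_ B nB) /nbhs_ballP[e /= e0 eB].
  have e2 : 0 < e / 2 by rewrite divr_gt0.
  apply: filterS (wc j a0 ja0 _ e2) => a wa ja.
  have [da ga] := gE _ _ ja.
  rewrite -[g0 a](chart_funK da) ga; apply: eB.
  rewrite -ball_normE/= distrC (le_lt_trans (wa ja))//.
  by rewrite ltr_pdivrMr// ltr_pMr// ltr1n.
pose f : mapping_space A M := (mkcts cf : continuousType A M).
have adf : admissible S f by move=> j a /gE[].
exists f => //; apply: bfunP => -[a j].
have [ja|nja] := pselect (cl j a).
  by rewrite coordinates_in//; exact: (gE _ _ ja).2.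
rewrite coordinates_out//; have := rad_FE rad _ wr (a, j).
by case: pselect => //= _; rewrite Fw0.
Qed.

End chart_at.
Arguments tangent {R A M n I atl f0} S.

(** * The chart around a continuous map *)

(** Smoothness into the model space is tested after its isometric embedding into
bounded functions ([Ck_descend]), so only this embedding and its range matter. *)
Record model_space (R : realType) (Z : normedModType R) (P : {pred Z}) := ModelSpace {
  model_sort : completeNormedModType R;
  model_incl : clinear model_sort Z;
  model_iso : forall x, `|model_incl x| = `|x|;
  model_range : range model_incl = [set z | z \in P] }.

Arguments model_iso {R Z P} m x.
Arguments model_range {R Z P} m.

Lemma model_space_of (R : realType) (Z : completeNormedModType R)
  (T : closed_submodule Z) : model_space (csub_pred T).
Proof.
pose E : completeNormedModType R := csub T.
pose val : E -> Z := csub_val.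
have lin : linear val by [].
have bnd (x : E) : `|val x| <= 1 * `|x| by rewrite mul1r.
exists E (mkclinear lin bnd) => //.
apply/seteqP; split=> [_ [x _ <-]|x xT]; first exact: csub_valP.
by exists (Csub xT).
Qed.

Section chart_at.
Context {R : realType} {A M : topologicalType} {n : nat} {I : Type}.
Local Notation V := 'rV[R]_n.
Variable atl : smooth_atlas M (fun _ : I => V).
Local Notation phi := (phi atl).
Local Notation adom := (adom atl).
Local Notation overlap := (overlap atl).
Local Notation tau := (tau atl).
Local Notation dtau := (dtau atl).
Hypothesis cA : compact [set: A].

Variables (f0 : mapping_space A M) (S : chart_system atl f0).
Local Notation N := (cs_size S).
Local Notation c := (@cs_idx _ _ _ _ _ _ _ S).
Local Notation cl := (@cs_cl _ _ _ _ _ _ _ S).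
Local Notation rho := (@cs_rho _ _ _ _ _ _ _ S).
Let X : Type := (A * 'I_N)%type.
Local Notation x0 := (evalmap f0).
Local Notation w0 := (coordinates S f0).
Local Notation F := (displacement_field (S := S)).
Local Notation G := (displacement (S := S)).

Variable rad : radii S.
Local Notation r := (rad_r rad).
Local Notation s := (rad_s rad).

Lemma coordinates_near f (e : R) : admissible S f -> 0 < e ->
  \forall g \near f, admissible S g /\ `|coordinates S g - coordinates S f| <= e.
Proof.
move=> adf e0.
have H (j : 'I_N) := chart_near_unif cA (phi := phi (c j)) (f := f)
  (cs_closed (c := S) (i := j)) (adf j) e0.
apply: filterS (filter_forall _ H) => g Hg.
have adg : admissible S g by move=> j a ja; have [] := Hg j a ja.
split=> //; apply/bfun_normP; first exact: ltW.
move=> [a j]; rewrite bfunBE; have [ja|nja] := pselect (cl j a).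
  by rewrite !coordinates_in//; have [] := Hg j a ja.
by rewrite !coordinates_out// subrr normr0 ltW.
Qed.

(** The domain of the chart around [f0]. *)
Definition near_maps : set (mapping_space A M) :=
  [set f | admissible S f /\ `|coordinates S f - w0| < s].

Lemma near_maps_open : open near_maps.
Proof.
rewrite openE => f [adf fs].
have e0 : 0 < (s - `|coordinates S f - w0|) / 2 by rewrite divr_gt0// subr_gt0.
suff : nbhs f near_maps by [].
have := coordinates_near adf e0; apply: filterS => g [adg gf].
split; first exact: adg.
rewrite -(subrK (coordinates S f) (coordinates S g)) -addrA (le_lt_trans (ler_normD _ _))//.
rewrite -ltrBrDr; apply: le_lt_trans gf _.
by rewrite ltr_pdivrMr// ltr_pMr ?ltr1n// subr_gt0.
Qed.

Lemma near_maps_base : near_maps f0.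
Proof. by split; [exact: admissible0|rewrite subrr normr0 rad_s_gt0]. Qed.

Definition section_model : model_space (csub_pred (tangent S)) :=
  model_space_of (tangent S).
Local Notation E := (model_sort section_model).
Local Notation iota := (model_incl section_model).

Definition section_chart_fun (f : mapping_space A M) : E :=
  xget 0 [set xi | iota xi = F (coordinates S f)].
Local Notation psi := section_chart_fun.

Lemma near_maps_r f : near_maps f -> `|coordinates S f - w0| <= r.
Proof. by move=> [_ fs]; rewrite (le_trans (ltW fs))// rad_sr. Qed.

Lemma section_model_inj : injective iota.
Proof.
move=> x y xy; apply/eqP; rewrite -subr_eq0 -normr_le0 -(model_iso section_model).
by rewrite linearB/= xy subrr normr0.
Qed.

Lemma section_chart_funE f : near_maps f -> iota (psi f) = F (coordinates S f).
Proof.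
move=> Df; have : [set z | z \in tangent_pred (S := S)] (F (coordinates S f)).
  by apply: (displacement_field_tangent cA (rad := rad)); [exact: Df.1|exact: near_maps_r].
rewrite -(model_range section_model) => -[x _ xF].
by rewrite /psi; case: xgetP => [y _ //|/(_ x)].
Qed.

Lemma coordinates_inj f g : admissible S f -> admissible S g ->
  coordinates S f = coordinates S g -> f = g.
Proof.
move=> adf adg fg; apply: evalmapP => a; have [j ja] := cs_cover S a.
rewrite -(chart_funK (adf _ _ ja)) -(chart_funK (adg _ _ ja)).
by rewrite -(coordinates_in cA adf ja) fg (coordinates_in cA adg ja).
Qed.

Lemma section_chart_funB f g : near_maps f -> near_maps g ->
  iota (psi f - psi g) = F (coordinates S f) - F (coordinates S g).
Proof.
move=> Df Dg; have -> : iota (psi f - psi g) = iota (psi f) - iota (psi g).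
  exact: linearB.
by congr (_ - _); exact: section_chart_funE.
Qed.

Lemma section_chart_fun_expand f g : near_maps f -> near_maps g ->
  `|coordinates S f - coordinates S g| <= 2 * `|psi f - psi g|.
Proof.
move=> Df Dg.
have -> : `|psi f - psi g| = `|F (coordinates S f) - F (coordinates S g)|.
  rewrite -(model_iso section_model (psi f - psi g)) section_chart_funB//.
exact: near_identity_expand (rad_id rad) (near_maps_r Df) (near_maps_r Dg).
Qed.

Lemma section_chart_fun_inj f g : near_maps f -> near_maps g -> psi f = psi g -> f = g.
Proof.
move=> Df Dg fg; apply: coordinates_inj; [exact: Df.1|exact: Dg.1|].
have := section_chart_fun_expand Df Dg; rewrite fg subrr normr0 mulr0 => hfg.
by apply/eqP; rewrite -subr_eq0 -normr_le0.
Qed.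

(** Surjectivity is [tangent_section]; the right hand side is open because [F] is an
open map. *)
Lemma section_chart_image : psi @` near_maps =
  [set xi | (F @` [set w | `|w - w0| < s]) (iota xi)].
Proof.
apply/seteqP; split=> [_ [f Df <-]|xi [w /= ws wxi]].
  by exists (coordinates S f); [exact: Df.2|rewrite section_chart_funE].
have Ft : F w \in tangent_pred (S := S).
  suff : [set z | z \in tangent_pred (S := S)] (F w) by [].
  by rewrite -(model_range section_model) wxi; exists xi.
have [f adf fw] := tangent_section cA ws Ft.
have Df : near_maps f by split; rewrite ?fw.
by exists f => //; apply: section_model_inj; rewrite section_chart_funE// fw.
Qed.

Lemma section_chart_image_open : open (psi @` near_maps).
Proof.
rewrite section_chart_image; apply: (open_comp (f := iota)) => [x _|].
  exact: clinear_continuous.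
apply: (near_identity_open (rad_id rad)) => [|w ws]; last first.
  exact: lt_le_trans ws (rad_sr rad).
have -> : [set w | `|w - w0| < s] = ball w0 s.
  by apply/seteqP; split=> w; rewrite -ball_normE/= distrC.
exact: ball_open.
Qed.

Lemma section_chart_fun_cts f : near_maps f -> {for f, continuous psi}.
Proof.
move=> Df; apply/(@cvgrPdist_le _ _ _ _ (nbhs_filter f)) => e e0.
have Fc : {for coordinates S f, continuous F}.
  apply: (Ck_continuous (rad_smooth rad 0)).
  by rewrite -ball_normE/= distrC (lt_le_trans Df.2)// rad_sr.
have /cvgrPdist_le/(_ e e0)/nbhs_ballP[d /= d0 dF] := Fc.
have d2 : 0 < d / 2 by rewrite divr_gt0.
have nD : nbhs f near_maps by exact: open_nbhs_nbhs (conj near_maps_open Df).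
apply: filterS (filterI nD (coordinates_near Df.1 d2)) => g [Dg [adg gf]].
rewrite -(model_iso section_model (psi f - psi g)) (section_chart_funB Df Dg).
apply: dF; rewrite -ball_normE/= distrC (le_lt_trans gf)//.
by rewrite ltr_pdivrMr// ltr_pMr// ltr1n.
Qed.

Definition section_chart_inv (xi : E) : mapping_space A M :=
  xget f0 [set f | near_maps f /\ psi f = xi].
Local Notation psiV := section_chart_inv.

Lemma section_chart_funK f : near_maps f -> psiV (psi f) = f.
Proof.
move=> Df; rewrite /psiV; case: xgetP => [g _ [Dg gf]|/(_ f) []//].
exact: section_chart_fun_inj.
Qed.

Lemma section_chart_inv_cts xi : (psi @` near_maps) xi -> {for xi, continuous psiV}.
Proof.
move=> xiD; have [f Df fxi] := xiD; rewrite -fxi.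
rewrite /prop_for/continuous_at section_chart_funK//.
apply: (proj2 (@mapping_space_cvgP _ _ (psiV @ psi f) f
  (fmap_filter _ (nbhs_filter (psi f))))) => K O cK oO fKO.
pose Q (j : 'I_N) (d : R) := forall g : mapping_space A M,
  (forall a, cl j a -> adom (c j) (evalmap g a) /\
    `|phi (c j) (evalmap g a) - phi (c j) (evalmap f a)| < d) ->
  forall a, cl j a -> K a -> O (evalmap g a).
have [d d0 dP] : exists2 d : R, 0 < d & forall j, Q j d.
  apply: finite_radius => [j e e' He e'0 e'e g ge|j].
    apply: He => a ja; have [dga ga] := ge a ja.
    by split; [exact: dga|exact: lt_le_trans e'e].
  exact: (@chart_near_open _ _ _ _ (phi (c j)) f (cl j) K O
    (cs_closed (i := j)) cK oO (Df.1 j) fKO).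
have d2 : 0 < d / 2 by rewrite divr_gt0.
have nimg : nbhs (psi f) (psi @` near_maps).
  by apply: open_nbhs_nbhs; split; [exact: section_chart_image_open|exists f].
have := nimg; apply: filter_app.
have : nbhs (psi f) (ball (psi f) (d / 2)) by exact: nbhsx_ballx.
apply: filterS => xi'; rewrite -ball_normE/= => fd [g Dg gxi].
rewrite -gxi section_chart_funK// => _ [a Ka <-]; have [j ja] := cs_cover S a.
apply: (dP j) (ja) (Ka) => b jb; split; first exact: Dg.1.
rewrite -!(coordinates_in cA _ jb); [|exact: Df.1|exact: Dg.1].
rewrite -bfunBE (le_lt_trans (bfun_le _ _))// distrC.
rewrite (le_lt_trans (section_chart_fun_expand Df Dg))// gxi mulrC -ltr_pdivlMr//.
Qed.

Definition section_chart : chart (mapping_space A M) E :=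
  Chart near_maps_open section_chart_image_open section_chart_funK
    section_chart_fun_cts section_chart_inv_cts.

End chart_at.

(** * Existence of the data for a chart *)

(** A filter of large finite sequences reduces this to the compactness criterion by
near covering. *)
Lemma compact_finite_cover (A : topologicalType) (O : A -> set A) :
  compact [set: A] -> (forall a, open (O a)) -> (forall a, O a a) ->
  exists l : seq A, forall a, exists2 b, b \in l & O b a.
Proof.
move=> cA oO Oa.
pose F : set_system (seq A) :=
  [set P | exists l0 : seq A, forall l : seq A, {subset l0 <= l} -> P l].
have FF : Filter F.
  split; first by exists [::].
    move=> P Q [p Pp] [q Qq]; exists (p ++ q) => l pql.
    by split; [apply: Pp|apply: Qq] => x xp; apply: pql; rewrite mem_cat xp ?orbT.
  by move=> P Q PQ [p Pp]; exists p => l /Pp; exact: PQ.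
have := (compact_near_coveringP [set: A]).1 cA (seq A) F
  (fun l a => exists2 b, b \in l & O b a) FF.
case=> [a _|l0 lP].
  exists (O a, [set l : seq A | a \in l]).
    split=> /=; first exact: open_nbhs_nbhs (conj (oO a) (Oa a)).
    by exists [:: a] => l; apply; rewrite mem_head.
  by move=> [a' l] [/= Oaa' al]; exists a.
by exists l0 => a; apply: lP.
Qed.

Section existence.
Context {R : realType} {M : topologicalType} {n : nat} {I : Type}.
Local Notation V := 'rV[R]_n.
Variable atl : smooth_atlas M (fun _ : I => V).
Local Notation phi := (phi atl).
Local Notation adom := (adom atl).
Hypothesis hM : hausdorff_space M.

(** The tent function of a small closed ball in a chart. Its support is compact, hence
closed in [M] by the Hausdorff property, so that the extension by zero is
continuous. *)
Lemma bump_function (y : M) : exists (i : I) (B : set M) (beta : M -> R),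
  [/\ closed B, B `<=` adom i, continuous beta, forall z, 0 <= beta z &
      0 < beta y /\ forall z, beta z != 0 -> B z].
Proof.
have [i dy] := atlas_cover atl y.
have img : (phi i @` adom i) (phi i y) by exists y.
have := open_nbhs_nbhs (conj (chart_img_open (phi i)) img).
move=> /nbhs_ballP[d /= d0 dP].
have d2 : 0 < d / 2 by rewrite divr_gt0.
pose C := [set v | `|phi i y - v| <= d / 2].
have Cimg v : C v -> (phi i @` adom i) v.
  move=> Cv; apply: dP; rewrite -ball_normE/= (le_lt_trans Cv)//.
  by rewrite ltr_pdivrMr// ltr_pMr// ltr1n.
have cC : compact C.
  apply: bounded_closed_compact.
    exists (`|phi i y| + d / 2); split; first exact: num_real.
    move=> x xP v Cv /=; rewrite (le_trans _ (ltW xP))//.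
    rewrite -[v](subrK (phi i y)) addrC (le_trans (ler_normD _ _))// lerD2l.
    by rewrite distrC.
  have -> : C = closed_ball_ (fun v => `|v|) (phi i y) (d / 2) by [].
  exact: closed_closed_ball_.
pose B := chart_inv (phi i) @` C.
have BE z : B z <-> adom i z /\ `|phi i y - phi i z| <= d / 2.
  split=> [[v Cv <-]|[dz Cz]]; last by exists (phi i z) => //; rewrite chart_funK.
  have [x dx xv] := Cimg _ Cv; move: Cv; rewrite -xv => Cv.
  by rewrite chart_funK.
have clB : closed B.
  apply: compact_closed hM _; apply: continuous_compact cC.
  apply: continuous_in_subspaceT => v /set_mem Cv.
  exact: chart_inv_cts (Cimg _ Cv).
pose beta z :=
  if pselect (adom i z) then Num.max 0 (d / 2 - `|phi i y - phi i z|) else 0.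
exists i, B, beta; split.
- exact: clB.
- by move=> z /BE[].
- move=> z; have [dz|ndz] := pselect (adom i z).
    have nd : nbhs z (adom i).
      exact: open_nbhs_nbhs (conj (chart_dom_open (phi i)) dz).
    have c1 : {for z, continuous (fun z => Num.max 0 (d / 2 - `|phi i y - phi i z|))}.
      apply: continuous_max; first exact: cst_continuous.
      apply: cvgB; first exact: cvg_cst.
      apply: cvg_norm; apply: cvgB; first exact: cvg_cst.
      exact: chart_fun_cts.
    have b1 w : adom i w -> Num.max 0 (d / 2 - `|phi i y - phi i w|) = beta w.
      by move=> dw; rewrite /beta; case: pselect.
    rewrite /continuous_at -(b1 _ dz); apply: cvg_trans c1.
    by apply: near_eq_cvg; apply: filterS nd => w /b1.
  have nB : nbhs z (~` B).
    by apply: open_nbhs_nbhs; split; [exact: closed_openC|move=> /BE[]].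
  have b0 w : ~ B w -> beta w = 0.
    move=> nBw; rewrite /beta; case: pselect => //= dw.
    apply/max_idPl; rewrite subr_le0 leNgt; apply/negP => /ltW lw.
    by apply: nBw; apply/BE.
  rewrite /continuous_at b0; last by move=> /BE[].
  apply: (@cvg_trans _ ((fun=> 0) @ z)); last exact: cvg_cst.
  by apply: near_eq_cvg; apply: filterS nB => w /b0 ->.
- by move=> z; rewrite /beta; case: pselect => //= _; rewrite le_max lexx.
- split.
    rewrite /beta; case: pselect => //= _.
    by rewrite subrr normr0 subr0 lt_max d2 orbT.
  move=> z; rewrite /beta; case: pselect => [dz|]/=; last by rewrite eqxx.
  move=> bz; apply/BE; split=> //; rewrite leNgt; apply/negP => lz; move/eqP: bz; apply.
  by apply/max_idPl; rewrite subr_le0 ltW.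
Qed.

Context {A : topologicalType}.
Hypothesis cA : compact [set: A].

(** Finitely many of the pulled back tent functions have a positive sum; dividing by it
gives the weights. *)
Lemma chart_system_exists (f : mapping_space A M) : inhabited (chart_system atl f).
Proof.
have [ii ib] := choice bump_function; have [BB ibB] := choice ib; have [bb bP] := choice ibB.
pose O a := [set b | 0 < bb (evalmap f a) (evalmap f b)].
have bcts a : continuous (fun b => bb (evalmap f a) (evalmap f b)).
  move=> b; apply: continuous_comp; first exact: evalmap_cts.
  by have [_ _ + _ _] := bP (evalmap f a); apply.
have Oop a : open (O a).
  by move/continuousP : (bcts a) => /(_ [set x : R | 0 < x]); apply; exact: open_gt.
have [D DA] : exists l : seq A, forall a, exists2 b, b \in l & O b a.
  apply: compact_finite_cover => // a.
  by have [_ _ _ _ []] := bP (evalmap f a).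
pose N := size D; pose pt (i : 'I_N) := tnth (in_tuple D) i.
pose y i := evalmap f (pt i).
pose tot a := \sum_(i < N) bb (y i) (evalmap f a).
have bge0 i z : 0 <= bb (y i) z by have [_ _ _ + _] := bP (y i); apply.
have tot0 a : 0 < tot a.
  have [b Db Oab] := DA a.
  have /tnthP[i bi] : b \in in_tuple D by [].
  rewrite /tot (bigD1 i)//= ltr_pwDl//; last by rewrite sumr_ge0.
  by rewrite /y /pt -bi; exact: Oab.
constructor.
apply: (@ChartSystem _ _ _ _ _ atl f N (fun i => ii (y i))
  (fun i => evalmap f @^-1` BB (y i)) _ _ (fun i a => bb (y i) (evalmap f a) / tot a)).
- move=> i; apply: preimage_closed.
    by move=> a _; exact: evalmap_cts.
  by have [] := bP (y i).
- by move=> i a; have [_ + _ _ _] := bP (y i); apply.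
- move=> i a; apply: cvgM; first exact: bcts.
  apply: cvgV; first by rewrite gt_eqF.
  by apply: cts_sum => k; exact: bcts.
- move=> i a; rewrite mulf_eq0 negb_or => /andP[bi _].
  by have [_ _ _ _ [_]] := bP (y i); apply.
- by move=> a; rewrite -mulr_suml -/(tot a) divff// lt0r_neq0.
Qed.
End existence.

(** * Transition maps between charts of the mapping space *)

Section transition.
Context {R : realType} {A M : topologicalType} {n : nat} {I : Type}.
Local Notation V := 'rV[R]_n.
Variable atl : smooth_atlas M (fun _ : I => V).
Local Notation phi := (phi atl).
Local Notation tau := (tau atl).
Hypothesis cA : compact [set: A].

Variables (f0 f1 : mapping_space A M).
Variables (S0 : chart_system atl f0) (S1 : chart_system atl f1).
Local Notation c0 := (@cs_idx _ _ _ _ _ _ _ S0).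
Local Notation cl0 := (@cs_cl _ _ _ _ _ _ _ S0).
Local Notation c1 := (@cs_idx _ _ _ _ _ _ _ S1).
Local Notation cl1 := (@cs_cl _ _ _ _ _ _ _ S1).
Let X0 : Type := (A * 'I_(cs_size S0))%type.
Let X1 : Type := (A * 'I_(cs_size S1))%type.

(** The value in a chart of the second system is computed from the value in one chart
of the first, chosen for each [a] by [k]. This choice is not continuous, which
does no harm in spaces of bounded functions. *)
Lemma coordinates_change (f : mapping_space A M) : admissible S0 f -> admissible S1 f ->
  exists H : bfun X0 V -> bfun X1 V, exists2 d : R, 0 < d &
  Cinfty (ball (coordinates S0 f) d) H /\
  forall g, admissible S0 g -> admissible S1 g ->
    ball (coordinates S0 f) d (coordinates S0 g) ->
    H (coordinates S0 g) = coordinates S1 g.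
Proof.
move=> ad0 ad1; have [k kP] := choice (cs_cover S0).
pose J : Type := ('I_(cs_size S0) * 'I_(cs_size S1))%type.
pose h (y : X1) : X0 := (y.1, k y.1).
pose P (p : J) (y : X1) := [/\ k y.1 = p.1, y.2 = p.2 & cl1 p.2 y.1].
pose nem (p : J) := nemytskii h (P p) (tau (c0 p.1) (c1 p.2)).
have [d d0 nemP] : exists2 d : R, 0 < d & forall p : 'I_(cs_size S0) * 'I_(cs_size S1),
    Cinfty (ball (coordinates S0 f) d) (nem p) /\
    forall w, ball (coordinates S0 f) d w -> forall y,
      nem p w y = if pselect (P p y) then tau (c0 p.1) (c1 p.2) (w (h y)) else 0.
  apply: finite_radius => [p d d' [Cd nd] d'0 d'd|[i j]].
    have sub : ball (coordinates S0 f) d' `<=` ball (coordinates S0 f) d by apply: le_ball.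
    split; first by move=> m; exact: Ck_subset (Cd m).
    by move=> w /sub; exact: nd.
  have [||||d d0 [Cd nd]] := @nemytskii_tau_smooth _ _ _ _ atl _ cA _ _ h (P (i, j))
    (coordinates S0 f) (evalmap f) (cl0 i `&` cl1 j) (c0 i) (c1 j).
  - exact: evalmap_cts.
  - by apply: closedI; exact: cs_closed.
  - by move=> a [ia ja]; split; [exact: ad0|exact: ad1].
  - move=> [a l] [/= <- _ ja]; exists a; first by split.
    by rewrite /h/= coordinates_in.
  - by exists d.
exists (fun w => \sum_(p : 'I_(cs_size S0) * 'I_(cs_size S1)) nem p w), d => //; split.
  by move=> m; apply: Ck_sum => p; exact: (nemP p).1.
move=> g adg0 adg1 gd; apply: bfunP => -[a j]; rewrite bfun_sumE.
have [ja|nja] := pselect (cl1 j a); last first.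
  rewrite coordinates_out// big1// => p _; rewrite (nemP p).2//.
  by case: pselect => //= -[/= _ <-].
rewrite (bigD1 (k a, j))//= big1 ?addr0 => [|p pn].
  rewrite (nemP _).2//; case: pselect => [_|nP] /=; last by exfalso; apply: nP.
  by rewrite /h/= !coordinates_in// tauE//; exact: adg0.
rewrite (nemP p).2//; case: pselect => //= -[/= kp jp _].
by exfalso; move/eqP: pn; apply; rewrite kp jp; case: p {kp jp}.
Qed.

Variables (rad0 : radii S0) (rad1 : radii S1).
Local Notation psi0 := (section_chart cA rad0).
Local Notation psi1 := (section_chart cA rad1).

(** On a neighborhood [W] of the image of [f] the transition is [F] after [H] after
[K], with [K] the local inverse of the first displacement and [H] the change of
coordinates. *)
Lemma transition_smooth : Cinfty
  (psi0 @` (chart_dom psi0 `&` chart_dom psi1)) (psi1 \o chart_inv psi0).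
Proof.
move=> k; set U := psi0 @` _.
have oU : open U by apply: chart_image_open; exact: chart_dom_open.
apply: Ck_local => // _ [f [D0f D1f] <-].
have [H [d d0 [CH HE]]] := coordinates_change D0f.1 D1f.1.
pose B := ball (coordinates S0 f0) (rad_s rad0) `&` ball (coordinates S0 f) d.
have oB : open B by apply: openI; exact: ball_open.
have Br w : B w -> `|w - coordinates S0 f0| < rad_r rad0.
  move=> [+ _]; rewrite -ball_normE/= distrC => ws.
  exact: lt_le_trans ws (rad_sr rad0).
have Finj w w' : `|w - coordinates S0 f0| <= rad_r rad0 ->
    `|w' - coordinates S0 f0| <= rad_r rad0 ->
    displacement_field (S := S0) w = displacement_field (S := S0) w' -> w = w'.
  move=> wr wr' ww'; apply/eqP; rewrite -subr_eq0 -normr_le0.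
  have := near_identity_expand (rad_id rad0) wr wr'.
  by rewrite ww' subrr normr0 mulr0.
pose K z := xget (coordinates S0 f0) [set w | B w /\ displacement_field w = z].
have KF w : B w -> K (displacement_field w) = w.
  move=> Bw; rewrite /K; case: xgetP => [w' _ [Bw' ww']|/(_ w) []//].
  exact: Finj (ltW (Br _ Bw')) (ltW (Br _ Bw)) ww'.
have CK := rad_inv oB Br KF.
have oFB : open (displacement_field (S := S0) @` B) := near_identity_open (rad_id rad0) oB Br.
pose W := U `&` model_incl (section_model S0) @^-1` (displacement_field (S := S0) @` B).
have oW : open W.
  apply: openI => //; apply: open_comp oFB => x _; exact: clinear_continuous.
have WP xi : W xi -> exists g,
    [/\ near_maps rad0 g, near_maps rad1 g, B (coordinates S0 g) &
    xi = psi0 g].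
  move=> [[g [D0g D1g] <-] [w Bw wg]]; exists g; split => //.
  suff <- : w = coordinates S0 g by [].
  apply: Finj (ltW (Br _ Bw)) (near_maps_r D0g) _.
  by rewrite wg /= (section_chart_funE cA D0g).
exists W; split => //.
  split; first by exists f.
  exists (coordinates S0 f); last by rewrite /= (section_chart_funE cA D0f).
  split; last exact: ballxx.
  by rewrite -ball_normE/= distrC; exact: D0f.2.
apply: (Ck_descend (iota := model_incl (section_model S1))) => //.
  exact: model_iso.
  by rewrite model_range; exact: csub_closed.
apply: (@Ck_congr _ k _ _ _ (displacement_field (S := S1) \o
  (H \o (K \o model_incl (section_model S0))))) => //.
  move=> _ /WP[g [D0g D1g Bg ->]] /=.
  rewrite (section_chart_funK cA D0g) (section_chart_funE cA D1g).
  rewrite (section_chart_funE cA D0g) (KF _ Bg).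
  by rewrite HE; [|exact: D0g.1|exact: D1g.1|exact: Bg.2].
have KW xi : W xi -> exists g,
    [/\ near_maps rad0 g, near_maps rad1 g, B (coordinates S0 g) &
    (K \o model_incl (section_model S0)) xi = coordinates S0 g].
  move=> /WP[g [D0g D1g Bg ->]]; exists g; split => //=.
  by rewrite (section_chart_funE cA D0g) KF.
apply: (Ck_comp (W := ball (coordinates S1 f1) (rad_r rad1))) (rad_smooth rad1 k) => //.
  move=> xi /KW[g [D0g D1g Bg /= ->]]; rewrite HE; [|exact: D0g.1|exact: D1g.1|exact: Bg.2].
  rewrite -ball_normE/= distrC; exact: lt_le_trans D1g.2 (rad_sr rad1).
apply: (Ck_comp (W := ball (coordinates S0 f) d)) (CH k) => //.
  by move=> xi /KW[g [_ _ Bg ->]]; exact: Bg.2.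
apply: (Ck_comp (W := displacement_field (S := S0) @` B)) (CK k) => //; first by move=> xi [].
exact: Ck_clinear.
Qed.
End transition.

Theorem theorem5p1 (R : realType) (A M : topologicalType) (n : nat) :
  compact [set: A] -> smooth_manifold R n M ->
  Banach_manifold R (mapping_space A M).
Proof.
move=> cA [hM [I [atl]]]; split; first exact: mapping_space_hausdorff.
pose J := {f : mapping_space A M & {S : chart_system atl f & radii S}}.
pose E (j : J) : completeNormedModType R :=
  model_sort (section_model (projT1 (projT2 j))).
exists J, E; constructor.
apply: (@SmoothAtlas R (mapping_space A M) J E
  (fun j => section_chart cA (projT2 (projT2 j)))).
  move=> f; have [S] := chart_system_exists atl hM cA f.
  have [rad] := radii_exist cA S.
  by exists (existT _ f (existT _ S rad)); exact: near_maps_base.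
by move=> i j; exact: transition_smooth.
Qed.
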